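(* Let $R\ge 3$, $r=\lfloor (R-1)/2\rfloor$, and let $q_{R,h}(x_h^* )$ be the WENO reconstruction (from point values or from cell averages) with exponent $s$ and parameter $\varepsilon>0$ defined in the context, for a function $f$ on the stencils $S_{R,h}$ built from the nodes $x_{i,h}=z+c_ih$. Assume that $s\ge (r+1)/2$ and that (i) if $3\le R\le 4$, then $z$ is not a critical point of $f$; (ii) if $R\ge 5$, then $z$ is not a critical point of $f$ of order $R-2$. Then $$q_{R,h}(x_h^* )=\begin{cases} f(x_h^* )+O(h^R)+O(\varepsilon) & \text{if } f\in\mathcal{C}^R,\\ f(x_h^* )+O(h^{r+1})+O(\varepsilon) & \text{if a discontinuity crosses } S_{R,h}.\end{cases}$$
   Context: Asymptotics. $g(h)=O(h^\alpha)$ means $\limsup_{h\to0}|g(h)/h^\alpha|<\infty$; $O(\varepsilon)$ denotes a term of order $\varepsilon$ in the small parameter $\varepsilon$. $\lfloor\cdot\rfloor$ and $\lceil\cdot\rceil$ are floor and ceiling, and $\Pi_k$ is the space of real polynomials of degree at most $k$. Critical points. $f$ has a critical point of order $k$ at $z$ if $f^{(j)}(z)=0$ for $1\le j\le k$ and $f^{(k+1)}(z)\ne0$ (order $0$ means $f'(z)\neq 0$, i.e. $z$ is not a critical point). Discontinuities. ''A discontinuity crosses a stencil'' means that $f$ has an isolated jump discontinuity separating the elements (nodes, or cells) of the stencil into two nonempty groups, $f$ being smooth on each side. Common setting. $h>0$, $R\ge3$, $r=\lfloor (R-1)/2\rfloor$, $r'=\lceil (R-1)/2\rceil$, $z\in\mathbb{R}$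 fixed, $x_{i,h}=z+c_ih$ with fixed reals $c_i<c_j$ for $i<j$. The reconstruction point is $x_h^*=z+c^*h$ with $c^*$ fixed. $s>0$ is an exponent and $\varepsilon>0$ a small parameter. Point-value framework. The stencil is $S_{R,h}=\{x_{0,h},\dots,x_{R-1,h}\}$, the data are $f_{i,h}=f(x_{i,h})$, and the substencils are $S_{R,i,h}=\{x_{i,h},\dots,x_{i+r,h}\}$, $0\le i\le r'$. The point $x_h^*$ lies between $x_{R/2-1,h}$ and $x_{R/2,h}$ if $R$ is even, and either between $x_{r-1,h}$ and $x_{r,h}$ or between $x_{r,h}$ and $x_{r+1,h}$ if $R$ is odd. $p_{R,i,h}\in\Pi_r$ satisfies $p_{R,i,h}(x_{j,h})=f_{j,h}$ for $i\le j\le i+r$, and $p_{R,h}\in\Pi_{R-1}$ satisfies $p_{R,h}(x_{j,h})=f_{j,h}$ for $0\le j\le R-1$. The smoothness indicators are $$I_{R,i,h}=\sum_{j=i}^{r+i-1}\left(\frac{f_{j+1,h}-f_{j,h}}{c_{j+1}-c_j}\right)^2,\quad 0\le i\le r',$$ and $d_{R,h}=(f[x_{0,h},\dots,x_{R-1,h}])^2$, with undivided differences $f[x_{i,h}]=f_{i,h}$ and $$f[x_{i,h},\dots,x_{i+j,h}]=\frac{f[x_{i+1,h},\dots,x_{i+j,h}]-f[x_{i,h},\dots,x_{i+j-1,h}]}{c_{i+j}-c_i}.$$ Cell-average framework. The interfaces are $x_{0,h},\dots,x_{R,h}$, the stencil $S_{R,h}$ consists of the cells $C_{j,h}=[x_{j,h},x_{j+1,h}]$,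 $0\le j\le R-1$, the data are $\bar f_{j,h}=\frac{1}{x_{j+1,h}-x_{j,h}}\int_{x_{j,h}}^{x_{j+1,h}}f(x)\,dx$, and the substencils are $S_{R,i,h}=\{C_{i,h},\dots,C_{i+r,h}\}$, $0\le i\le r'$. The point satisfies $x_{(R+1)/2-1,h}\le x_h^*\le x_{(R+1)/2,h}$ if $R$ is odd and $x_{R/2-1,h}\le x_h^*\le x_{R/2+1,h}$ if $R$ is even. $p_{R,i,h}\in\Pi_r$ (respectively $p_{R,h}\in\Pi_{R-1}$) is the polynomial whose average over $C_{j,h}$ equals $\bar f_{j,h}$ for $i\le j\le i+r$ (respectively for $0\le j\le R-1$). The smoothness indicators are $$I_{R,i,h}=\sum_{j=i}^{r+i-1}\left(\frac{\bar f_{j+1,h}-\bar f_{j,h}}{\bar c_{j+1}-\bar c_j}\right)^2,\quad \bar c_j=\tfrac12(c_j+c_{j+1}),\quad 0\le i\le r',$$ and $d_{R,h}=\big(h^{R-1}p_{R,h}^{(R-1)}\big)^2$, where $p_{R,h}^{(R-1)}$ is the (constant) derivative of order $R-1$. Weights and reconstruction (both frameworks). For $0\le i\le r'$, $$\alpha_{R,i,h}=\frac{1}{r'+1}\left(1+\frac{d_{R,h}^s}{I_{R,i,h}^s+\varepsilon}\right),\qquad \omega_{R,i,h}=\frac{\alpha_{R,i,h}}{\sum_{j=0}^{r'}\alpha_{R,j,h}},$$ $$\tilde q_{R,h}(x_h^* )=\sum_{i=0}^{r'}\omega_{R,i,h}\,p_{R,i,h}(x_h^* ),\qquad J_{R,h,s}=\sum_{i=0}^{r'}\frac{1}{I_{R,i,h}^s+\varepsilon},\qquad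 \omega_{R,h}=\frac{1}{1+d_{R,h}^sJ_{R,h,s}},$$ $$q_{R,h}(x_h^* )=\omega_{R,h}\,p_{R,h}(x_h^* )+(1-\omega_{R,h})\,\tilde q_{R,h}(x_h^* ).$$
   Formalization: In the discontinuous case it is additionally assumed that every substencil not crossed by the discontinuity lies on the same side of it as x_h^*; without this the claim fails, e.g. for R=4 point values with the jump in the middle interval. *)

(* Defs.v *)
From Stdlib Require Import Reals Lra Lia Arith.
From Coquelicot Require Import Coquelicot.
Open Scope R_scope.

(* The stencil size, R in the paper, is written n here, since R is the type of
   real numbers.  Indices run over nat; a family such as c : nat -> R is only
   ever read at the indices of the stencil. *)

(* a^s for a >= 0 and s > 0.  Rpower cannot be used at a = 0: Rpower 0 s = 1. *)
Definition rpow (a s : R) : R := if Rlt_dec 0 a then Rpower a s else 0.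

Definition polynomial (k : nat) (p : R -> R) : Prop :=
  exists a : nat -> R, forall x, p x = sum_f_R0 (fun j => a j * x ^ j) k.

Definition C_near (k : nat) (f : R -> R) (x : R) : Prop :=
  locally x (fun y =>
    (forall j, (j <= k)%nat -> ex_derive_n f j y) /\ continuous (Derive_n f k) y).

(* is_derive and is_derive_n assert that the derivatives exist, which Derive
   and Derive_n do not: a point where f is not differentiable is not critical. *)
Definition critical_point (f : R -> R) (z : R) : Prop := is_derive f z 0.

Definition critical_point_of_order (k : nat) (f : R -> R) (z : R) : Prop :=
  (forall j, (1 <= j <= k)%nat -> is_derive_n f j z 0) /\
  (exists l, l <> 0 /\ is_derive_n f (S k) z l).

(* g(h, eps) = O(h^k) + O(eps) as h and eps tend to 0 from above. *)
Definition bigO_h_eps (k : nat) (g : R -> R -> R) : Prop :=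
  exists A B : R -> R -> R,
    (forall h eps, 0 < h -> 0 < eps -> g h eps = A h eps + B h eps) /\
    exists C delta, 0 < delta /\
      forall h eps, 0 < h < delta -> 0 < eps < delta ->
        Rabs (A h eps) <= C * h ^ k /\ Rabs (B h eps) <= C * eps.

Inductive framework := point_values | cell_averages.

Section Stencil.

Variables (fw : framework) (n : nat) (c : nat -> R) (z : R).

(* floor ((n-1)/2) and ceil ((n-1)/2) *)
Definition rlow : nat := (n - 1) / 2.
Definition rhigh : nat := n / 2.

Definition node (h : R) (i : nat) : R := z + c i * h.

(* There are n nodes for point values, n + 1 interfaces for n cells. *)
Definition last_node : nat :=
  match fw with point_values => n - 1 | cell_averages => n end.

Definition increasing_nodes : Prop :=
  forall i j, (i < j <= last_node)%nat -> c i < c j.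

Definition point_position (cs : R) : Prop :=
  forall h, 0 < h ->
  let x := z + cs * h in
  match fw with
  | point_values =>
      (Nat.Even n -> node h (n / 2 - 1) <= x <= node h (n / 2)) /\
      (Nat.Odd n -> node h (rlow - 1) <= x <= node h rlow \/
                    node h rlow <= x <= node h (rlow + 1))
  | cell_averages =>
      (Nat.Odd n -> node h ((n + 1) / 2 - 1) <= x <= node h ((n + 1) / 2)) /\
      (Nat.Even n -> node h (n / 2 - 1) <= x <= node h (n / 2 + 1))
  end.

(* f_{j,h}, respectively the average of f over the cell C_{j,h} *)
Definition data (f : R -> R) (h : R) (j : nat) : R :=
  match fw with
  | point_values => f (node h j)
  | cell_averages =>
      RInt f (node h j) (node h (S j)) / (node h (S j) - node h j)
  end.

Definition reconstructs (f : R -> R) (h : R) (i k : nat) (p : R -> R) : Prop :=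
  polynomial (k - i) p /\
  forall j, (i <= j <= k)%nat -> data p h j = data f h j.

Definition abscissa (j : nat) : R :=
  match fw with
  | point_values => c j
  | cell_averages => (c j + c (S j)) / 2
  end.

Definition smoothness (f : R -> R) (h : R) (i : nat) : R :=
  sum_f i (rlow + i - 1)
    (fun j => ((data f h (j + 1) - data f h j) /
               (abscissa (j + 1) - abscissa j)) ^ 2).

(* undivided v j i is the difference of the values v i, ..., v (i + j) *)
Fixpoint undivided (v : nat -> R) (j i : nat) : R :=
  match j with
  | O => v i
  | S j' => (undivided v j' (S i) - undivided v j' i) / (c (i + j) - c i)
  end.

(* p is the reconstruction on the whole stencil, of degree at most n - 1, so
   its derivative of order n - 1 may be taken at any point. *)
Definition global_indicator (f p : R -> R) (h : R) : R :=
  match fw with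
  | point_values => (undivided (data f h) (n - 1) 0) ^ 2
  | cell_averages => (h ^ (n - 1) * Derive_n p (n - 1) z) ^ 2
  end.

Section Weights.

Variables (s eps d : R) (I : nat -> R).

Definition alpha (i : nat) : R :=
  / INR (rhigh + 1) * (1 + rpow d s / (rpow (I i) s + eps)).

Definition local_weight (i : nat) : R := alpha i / sum_f_R0 alpha rhigh.

Definition J_sum : R := sum_f_R0 (fun i => / (rpow (I i) s + eps)) rhigh.

Definition global_weight : R := / (1 + rpow d s * J_sum).

Definition weno_combination (P : nat -> R) (p : R) : R :=
  global_weight * p +
  (1 - global_weight) * sum_f_R0 (fun i => local_weight i * P i) rhigh.

End Weights.

(* q is the value of the reconstruction at z + cs * h.  The polynomials p and
   P i exist and are uniquely determined by the data. *)
Definition weno_value (f : R -> R) (cs s h eps q : R) : Prop :=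
  exists (p : R -> R) (P : nat -> R -> R),
    reconstructs f h 0 (n - 1) p /\
    (forall i, (i <= rhigh)%nat -> reconstructs f h i (i + rlow) (P i)) /\
    q = weno_combination s eps (global_indicator f p h) (smoothness f h)
          (fun i => P i (z + cs * h)) (p (z + cs * h)).

(* f coincides near xi with fl on the left of xi and with fr on its right. *)
Definition jump (f fl fr : R -> R) (xi : R) : Prop :=
  C_near n fl xi /\ C_near n fr xi /\ fl xi <> fr xi /\
  locally xi (fun x => (x < xi -> f x = fl x) /\ (xi < x -> f x = fr x)).

(* The point xi itself belongs to the side, if any, whose limit is f xi. *)
Definition left_point (f fl : R -> R) (xi x : R) : Prop :=
  x < xi \/ (x = xi /\ f xi = fl xi).

Definition right_point (f fr : R -> R) (xi x : R) : Prop :=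
  xi < x \/ (x = xi /\ f xi = fr xi).

Definition left_element (f fl : R -> R) (xi h : R) (j : nat) : Prop :=
  match fw with
  | point_values => left_point f fl xi (node h j)
  | cell_averages => node h (S j) <= xi
  end.

Definition right_element (f fr : R -> R) (xi h : R) (j : nat) : Prop :=
  match fw with
  | point_values => right_point f fr xi (node h j)
  | cell_averages => xi <= node h j
  end.

Definition crosses (f fl fr : R -> R) (xi h : R) : Prop :=
  exists m : nat, (0 < m < n)%nat /\
    (forall j, (j < m)%nat -> left_element f fl xi h j) /\
    (forall j, (m <= j < n)%nat -> right_element f fr xi h j).

(* The discontinuity does not separate the point x from a substencil which it
   does not cross.  Otherwise that substencil, which carries the smooth data on
   the wrong side of xi, keeps a weight of order 1. *)
Definition same_side (f fl fr : R -> R) (xi h x : R) : Prop :=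
  forall i, (i <= rhigh)%nat ->
    ((forall j, (i <= j <= i + rlow)%nat -> left_element f fl xi h j) ->
       left_point f fl xi x) /\
    ((forall j, (i <= j <= i + rlow)%nat -> right_element f fr xi h j) ->
       right_point f fr xi x).

End Stencil.

(* Main.v *)
Require Import Defs.
From Stdlib Require Import Reals Lra Lia Arith.
From Coquelicot Require Import Coquelicot.
Open Scope R_scope.

(** Put [x = z + t h].  In the variable [t] the nodes [c i] are fixed, only the
    sampled function [t |-> f (z + t h)] depends on [h], and all constants come
    from finitely many interpolation problems that do not change.  Polynomials
    with small data have small coefficients ([sample_stable]), so a
    reconstruction is as good as any polynomial that nearly matches the data
    ([reconstruction_near_best]).  Compared with the Taylor polynomials of [f] at
    [z], the global reconstruction has an error of order [h ^ n] and a local one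
    of order [h ^ (r + 1)], where [r = rlow n].  The global indicator is the
    square of a fixed multiple of the leading coefficient of the rescaled global
    reconstruction ([global_indicator_lead]).

    Smooth data.  Let [m] be the order of the first derivative of [f] that does
    not vanish at [z].  If [m <= n - 2], every local indicator is at least of
    order [h ^ (2 m)] ([smoothness_lower_bound]): neighbouring data of [t ^ m]
    cannot agree throughout a substencil.  The global indicator is of order
    [h ^ (2 (n - 1))], smaller by a factor [h ^ 2], and the power [s] turns this
    factor into [h ^ (r + 1)] because [2 s >= r + 1].  This bounds the total
    weight of the local reconstructions, each of which contributes a further
    [h ^ (r + 1)]; and [2 (r + 1) >= n].  Otherwise all derivatives of order 1
    to [n - 1] vanish, since a critical point of order [n - 2] is excluded.
    Then [f] is constant up to [h ^ n], every reconstruction is that accurate,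
    and so is every convex combination.

    Data with a jump.  The nodes shrink to [z], so the jump lies at [z], and the
    same elements are on its left for every [h].  The data tend to a step, which
    no polynomial of degree at most [n - 2] matches ([step_lead_neq0], by Rolle);
    hence the global indicator stays away from zero.  So do the local indicators
    of the crossed substencils, whereas at least one substencil is not crossed
    and has an indicator of order [h ^ 2].  Its weight dominates: the global
    reconstruction and the crossed substencils get weights of order
    [h ^ (r + 1) + eps] and have bounded errors ([weno_error_jump]).  An uncrossed
    substencil sees smooth data, on the side of the jump where the reconstruction
    point lies. *)

(** * Polynomials and interpolation *)

Lemma choose_upto N (P : nat -> R -> Prop) :
  (forall j, (j <= N)%nat -> exists t, P j t) ->
  exists u : nat -> R, forall j, (j <= N)%nat -> P j (u j).
Proof.
  induction N as [|N IH]; intros H.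
  - destruct (H 0%nat ltac:(lia)) as (t & Ht).
    exists (fun _ => t). intros j Hj. now replace j with 0%nat by lia.
  - destruct IH as (u & Hu); [intros; apply H; lia|].
    destruct (H (S N) ltac:(lia)) as (t & Ht).
    exists (fun j => if Nat.eq_dec j (S N) then t else u j). intros j Hj.
    destruct (Nat.eq_dec j (S N)) as [->|]; [exact Ht|apply Hu; lia].
Qed.

Definition polyn (a : nat -> R) (k : nat) (x : R) : R :=
  sum_f_R0 (fun j => a j * x ^ j) k.

Lemma poly_head a k x :
  polyn a (S k) x = a 0%nat + x * polyn (fun l => a (S l)) k x.
Proof.
  unfold polyn. rewrite decomp_sum by lia. simpl Nat.pred.
  rewrite scal_sum, pow_O, Rmult_1_r. f_equal.
  apply sum_eq. intros i _. simpl. ring.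
Qed.

Lemma poly_last a k x : polyn a (S k) x = polyn a k x + a (S k) * x ^ S k.
Proof. reflexivity. Qed.

Lemma poly_coef0 a k : polyn a k 0 = a 0%nat.
Proof.
  destruct k.
  - unfold polyn; simpl; ring.
  - rewrite poly_head; ring.
Qed.

Lemma poly_ext a b k x :
  (forall l, (l <= k)%nat -> a l = b l) -> polyn a k x = polyn b k x.
Proof.
  intros H. apply sum_eq. intros i Hi. now rewrite H.
Qed.

Lemma poly_sub a b k x : polyn a k x - polyn b k x = polyn (fun l => a l - b l) k x.
Proof.
  unfold polyn. rewrite <- minus_sum. apply sum_eq. intros; ring.
Qed.

Lemma poly_bound a k x M B :
  (forall l, (l <= k)%nat -> Rabs (a l) <= M) -> Rabs x <= B -> 1 <= B ->
  Rabs (polyn a k x) <= INR (S k) * B ^ k * M.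
Proof.
  intros Ha Hx HB.
  replace (INR (S k) * B ^ k * M) with (sum_f_R0 (fun _ => B ^ k * M) k)
    by (rewrite sum_cte; ring).
  unfold polyn. eapply Rle_trans; [apply Rsum_abs|].
  apply sum_Rle. intros l Hl.
  rewrite Rabs_mult, Rmult_comm, <- RPow_abs.
  apply Rmult_le_compat; auto using Rabs_pos.
  - apply pow_le, Rabs_pos.
  - apply Rle_trans with (B ^ l).
    + apply pow_incr; split; auto using Rabs_pos.
    + apply Rle_pow; auto.
Qed.

Lemma poly_mul_affine u v w b k :
  exists a, (forall x, polyn a (S k) x = w + (u + v * x) * polyn b k x) /\
            a (S k) = v * b k.
Proof.
  (* [b (S k)] is not a coefficient of [polyn b k] and must not enter. *)
  exists (fun l => match l with
             | O => w + u * b O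
             | S l' => (if Nat.eq_dec l' k then 0 else u * b (S l')) + v * b l'
             end).
  split.
  - intros x. rewrite poly_head.
    assert (H : forall k', (k' <= k)%nat ->
      w + u * b 0%nat +
        x * polyn (fun l' => (if Nat.eq_dec l' k then 0 else u * b (S l')) + v * b l') k' x
      = w + (u + v * x) * polyn b k' x +
        (if Nat.eq_dec k' k then 0 else u * b (S k') * x ^ S k')).
    { induction k' as [|k' IH]; intros Hk'.
      - unfold polyn; cbn [sum_f_R0]. destruct (Nat.eq_dec 0 k); simpl; ring.
      - rewrite !poly_last.
        rewrite Rmult_plus_distr_l, <- Rplus_assoc, IH by lia.
        destruct (Nat.eq_dec k' k); [lia|].
        destruct (Nat.eq_dec (S k') k); simpl; ring. }
    rewrite H by lia. destruct (Nat.eq_dec k k); [ring|lia].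
  - destruct (Nat.eq_dec k k); [ring|lia].
Qed.

Lemma poly_rescale a k z h :
  exists b, (forall t, polyn a k (z + t * h) = polyn b k t) /\ b k = a k * h ^ k.
Proof.
  revert a. induction k as [|k IH]; intros a.
  - exists a. split; [intros t; unfold polyn; simpl; ring|simpl; ring].
  - destruct (IH (fun l => a (S l))) as (b & Hb & Hlead).
    destruct (poly_mul_affine z h (a 0%nat) b k) as (b' & Hb' & Hlead').
    exists b'. split.
    + intros t. rewrite poly_head, Hb, Hb'. ring.
    + rewrite Hlead', Hlead. simpl. ring.
Qed.

(** Division of a polynomial by [x - t]; the middle clause recovers the
    coefficients of the dividend from those of the quotient. *)
Lemma poly_divide a k t :
  exists b, b (S k) = 0 /\
    (forall l, (l <= k)%nat -> a (S l) = b l - t * b (S l)) /\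
    (forall x, polyn a (S k) x = polyn a (S k) t + (x - t) * polyn b k x).
Proof.
  revert a. induction k as [|k IH]; intros a.
  - exists (fun l => match l with O => a 1%nat | _ => 0 end).
    repeat split.
    + intros l Hl. replace l with 0%nat by lia. simpl. ring.
    + intros x. unfold polyn; simpl. ring.
  - destruct (IH (fun l => a (S l))) as (b & Hlast & Hrec & Hdiv).
    exists (fun l => match l with
               | O => polyn (fun l => a (S l)) (S k) t | S l' => b l' end).
    repeat split.
    + exact Hlast.
    + intros [|l] Hl; [|apply Hrec; lia].
      pose proof (Hdiv 0) as H0. rewrite !poly_coef0 in H0. simpl. lra.
    + intros x. rewrite poly_head, (poly_head a _ t), Hdiv.
      rewrite (poly_head _ k x). cbv beta iota.
      change (polyn (fun l => b l) k x) with (polyn b k x). ring.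
Qed.

(** Interpolation is well posed: the coefficients are bounded by the data.
    Dividing out the first node leaves a polynomial of smaller degree, whose
    data are difference quotients of the given ones. *)
Lemma interpolation_stable k (t : nat -> R) :
  (forall i j, (i < j <= k)%nat -> t i < t j) ->
  exists C, 0 <= C /\ forall a M,
    (forall j, (j <= k)%nat -> Rabs (polyn a k (t j)) <= M) ->
    forall l, (l <= k)%nat -> Rabs (a l) <= C * M.
Proof.
  revert t. induction k as [|k IH]; intros t Ht.
  - exists 1. split; [lra|]. intros a M H l Hl.
    specialize (H 0%nat ltac:(lia)). unfold polyn in H; simpl in H.
    replace l with 0%nat by lia. rewrite Rmult_1_r in H. lra.
  - destruct (IH (fun j => t (S j))) as (C & HC & HS); [intros; apply Ht; lia|].
    set (g := t 1%nat - t 0%nat).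
    assert (Hg : 0 < g) by (unfold g; pose proof (Ht 0%nat 1%nat ltac:(lia)); lra).
    set (N := C * (2 / g)).
    assert (HN : 0 <= N) by (apply Rmult_le_pos; [lra|apply Rdiv_le_0_compat; lra]).
    pose proof (Rabs_pos (t 0%nat)) as Ht0.
    exists (1 + (1 + Rabs (t 0%nat)) * N). split; [nra|].
    intros a M HM l Hl.
    assert (HMpos : 0 <= M) by
      (pose proof (HM 0%nat ltac:(lia)); pose proof (Rabs_pos (polyn a (S k) (t 0%nat))); lra).
    destruct (poly_divide a k (t 0%nat)) as (b & Hlast & Hrec & Hdiv).
    assert (Hb : forall l, (l <= k)%nat -> Rabs (b l) <= N * M).
    { intros l' Hl'. unfold N. rewrite Rmult_assoc.
      apply HS; [|exact Hl']. intros j Hj.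
      assert (Hgap : g <= t (S j) - t 0%nat).
      { unfold g. destruct j; [lra|]. pose proof (Ht 1%nat (S (S j)) ltac:(lia)). lra. }
      assert (Heq : polyn b k (t (S j)) =
        (polyn a (S k) (t (S j)) - polyn a (S k) (t 0%nat)) / (t (S j) - t 0%nat)).
      { rewrite (Hdiv (t (S j))). field. lra. }
      rewrite Heq. unfold Rdiv at 1. rewrite Rabs_mult.
      rewrite (Rabs_right (/ _)) by (apply Rle_ge, Rlt_le, Rinv_0_lt_compat; lra).
      replace (2 / g * M) with ((2 * M) * / g) by (field; lra).
      apply Rmult_le_compat.
      - apply Rabs_pos.
      - apply Rlt_le, Rinv_0_lt_compat; lra.
      - pose proof (HM (S j) ltac:(lia)). pose proof (HM 0%nat ltac:(lia)).
        unfold Rminus at 1. eapply Rle_trans; [apply Rabs_triang|].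
        rewrite Rabs_Ropp. lra.
      - apply Rinv_le_contravar; lra. }
    assert (Hprod : forall l, (l <= k)%nat ->
      Rabs (t 0%nat * b l) <= Rabs (t 0%nat) * (N * M)).
    { intros l' Hl'. rewrite Rabs_mult. apply Rmult_le_compat_l; auto. }
    assert (HNM : 0 <= N * M) by nra.
    destruct l as [|l].
    + assert (Ha0 : a 0%nat = polyn a (S k) (t 0%nat) - t 0%nat * b 0%nat).
      { pose proof (Hdiv 0) as H0. rewrite !poly_coef0 in H0. rewrite H0. ring. }
      rewrite Ha0. unfold Rminus.
      eapply Rle_trans; [apply Rabs_triang|]. rewrite Rabs_Ropp.
      pose proof (HM 0%nat ltac:(lia)). pose proof (Hprod 0%nat ltac:(lia)). nra.
    + rewrite Hrec by lia. unfold Rminus.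
      eapply Rle_trans; [apply Rabs_triang|]. rewrite Rabs_Ropp.
      pose proof (Hb l ltac:(lia)).
      assert (Rabs (t 0%nat * b (S l)) <= Rabs (t 0%nat) * (N * M)).
      { destruct (Nat.eq_dec l k) as [->|].
        - rewrite Hlast, Rmult_0_r, Rabs_R0. nra.
        - apply Hprod; lia. }
      nra.
Qed.

Lemma interpolation_exists k (t v : nat -> R) :
  (forall i j, (i < j <= k)%nat -> t i < t j) ->
  exists a, forall j, (j <= k)%nat -> polyn a k (t j) = v j.
Proof.
  revert t v. induction k as [|k IH]; intros t v Ht.
  - exists v. intros j Hj. replace j with 0%nat by lia. unfold polyn; simpl; ring.
  - destruct (IH (fun j => t (S j)) (fun j => (v (S j) - v 0%nat) / (t (S j) - t 0%nat)))
      as (b & Hb); [intros; apply Ht; lia|].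
    destruct (poly_mul_affine (- t 0%nat) 1 (v 0%nat) b k) as (a & Ha & _).
    exists a. intros [|j] Hj; rewrite Ha.
    + ring.
    + rewrite Hb by lia. pose proof (Ht 0%nat (S j) ltac:(lia)). field. lra.
Qed.

Lemma is_derive_poly a k x :
  is_derive (polyn a (S k)) x (polyn (fun l => INR (S l) * a (S l)) k x).
Proof.
  induction k as [|k IH].
  - unfold polyn; simpl. auto_derive; [exact I|]. ring.
  - apply (is_derive_ext (fun y => polyn a (S k) y + a (S (S k)) * y ^ S (S k))).
    { intros; symmetry; apply poly_last. }
    rewrite poly_last. apply (is_derive_plus (polyn a (S k))); [exact IH|].
    auto_derive; [exact I|]. 
    change (match k with 0%nat => 1 | S _ => INR k + 1 end) with (INR (S k)).
    rewrite (S_INR (S k)), <- tech_pow_Rmult. ring.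
Qed.

Lemma continuous_poly a k x : continuous (polyn a k) x.
Proof.
  destruct k.
  - apply (continuous_ext (fun _ => a 0%nat)); [intros; unfold polyn; simpl; ring|].
    apply continuous_const.
  - apply @ex_derive_continuous. eexists. apply is_derive_poly.
Qed.

Definition primitive_coef (a : nat -> R) (l : nat) : R :=
  match l with O => 0 | S l' => a l' / INR (S l') end.

Lemma is_derive_primitive a k x :
  is_derive (polyn (primitive_coef a) (S k)) x (polyn a k x).
Proof.
  rewrite <- (poly_ext (fun l => INR (S l) * primitive_coef a (S l))).
  - apply is_derive_poly.
  - intros l _. unfold primitive_coef. field. apply not_0_INR; lia.
Qed.

Lemma Derive_n_lead a k x : Derive_n (polyn a k) k x = INR (fact k) * a k.
Proof.
  revert a x. induction k as [|k IH]; intros a x.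
  - simpl. unfold polyn; simpl; ring.
  - replace (S k) with (k + 1)%nat at 2 by lia.
    rewrite <- Derive_n_comp.
    rewrite (Derive_n_ext _ (polyn (fun l => INR (S l) * a (S l)) k)).
    + rewrite IH. rewrite fact_simpl, mult_INR. ring.
    + intros t. apply is_derive_unique, is_derive_poly.
Qed.

Lemma rolle f df a b :
  a < b -> (forall x, is_derive f x (df x)) -> f a = f b ->
  exists x, a < x < b /\ df x = 0.
Proof.
  intros Hab Hd Hf.
  destruct (MVT_cor2 f df a b Hab) as (x & Hx & Hin).
  - intros x _. apply is_derive_Reals, Hd.
  - exists x. split; [exact Hin|].
    apply Rmult_eq_reg_r with (b - a); lra.
Qed.

(** Leibniz's rule for the divided differences of [x g(x)]. *)
Lemma undivided_mul_id c v k i :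
  (forall i' j', (i <= i' < j')%nat -> (j' <= i + S k)%nat -> c i' < c j') ->
  undivided c (fun j => c j * v j) (S k) i =
  c i * undivided c v (S k) i + undivided c v k (S i).
Proof.
  revert i. induction k as [|k IH]; intros i Hc.
  - simpl. pose proof (Hc i (i + 1)%nat ltac:(lia) ltac:(lia)).
    replace (i + 1)%nat with (S i) in * by lia. field. lra.
  - change (undivided c (fun j => c j * v j) (S (S k)) i) with
      ((undivided c (fun j => c j * v j) (S k) (S i) -
        undivided c (fun j => c j * v j) (S k) i) / (c (i + S (S k))%nat - c i)).
    rewrite !IH by (intros; apply Hc; lia).
    change (undivided c v (S (S k)) i) with
      ((undivided c v (S k) (S i) - undivided c v (S k) i) / (c (i + S (S k))%nat - c i)).
    assert (E : undivided c v k (S (S i)) =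
      undivided c v k (S i) + (c (i + S (S k))%nat - c (S i)) * undivided c v (S k) (S i)).
    { change (undivided c v (S k) (S i)) with
        ((undivided c v k (S (S i)) - undivided c v k (S i)) / (c (S i + S k)%nat - c (S i))).
      replace (S i + S k)%nat with (i + S (S k))%nat by lia.
      pose proof (Hc (S i) (i + S (S k))%nat ltac:(lia) ltac:(lia)). field. lra. }
    rewrite E.
    pose proof (Hc i (i + S (S k))%nat ltac:(lia) ltac:(lia)). field. lra.
Qed.

Lemma undivided_ext c u v k i :
  (forall j, (i <= j <= i + k)%nat -> u j = v j) ->
  undivided c u k i = undivided c v k i.
Proof.
  revert i. induction k as [|k IH]; intros i H; simpl.
  - apply H; lia.
  - rewrite !IH; auto; intros; apply H; lia.
Qed.

Lemma undivided_plus_const c v w k i :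
  undivided c (fun j => w + v j) (S k) i = undivided c v (S k) i.
Proof.
  revert i. induction k as [|k IH]; intros i.
  - simpl. f_equal. ring.
  - change (undivided c (fun j => w + v j) (S (S k)) i) with
      ((undivided c (fun j => w + v j) (S k) (S i) -
        undivided c (fun j => w + v j) (S k) i) / (c (i + S (S k))%nat - c i)).
    rewrite !IH. reflexivity.
Qed.

(** By Horner's scheme a polynomial is a constant plus [x] times a polynomial of
    smaller degree, whose difference of order [S k] vanishes because its
    differences of order [k] are all equal. *)
Lemma undivided_poly c a k i :
  (forall i' j', (i <= i' < j')%nat -> (j' <= i + k)%nat -> c i' < c j') ->
  undivided c (fun j => polyn a k (c j)) k i = a k.
Proof.
  revert a i. induction k as [|k IH]; intros a i Hc.
  - simpl. unfold polyn; simpl; ring.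
  - rewrite (undivided_ext _ _ (fun j => a 0%nat + c j * polyn (fun l => a (S l)) k (c j)))
      by (intros; apply poly_head).
    rewrite (undivided_plus_const c (fun j => c j * polyn (fun l => a (S l)) k (c j))).
    rewrite undivided_mul_id by exact Hc.
    rewrite IH by (intros; apply Hc; lia).
    change (undivided c (fun j => polyn (fun l => a (S l)) k (c j)) (S k) i) with
      ((undivided c (fun j => polyn (fun l => a (S l)) k (c j)) k (S i) -
        undivided c (fun j => polyn (fun l => a (S l)) k (c j)) k i) / (c (i + S k)%nat - c i)).
    rewrite !IH by (intros; apply Hc; lia).
    unfold Rdiv. ring.
Qed.

(** * Taylor expansions at the base point of the stencil *)

(** Coefficients in [t] of the Taylor polynomials of [f (z + t h)]. *)
Definition taylor_coef (f : R -> R) (z h : R) (l : nat) : R :=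
  Derive_n f l z / INR (fact l) * h ^ l.

Lemma taylor_coef_scale f z k h t :
  polyn (taylor_coef f z h) k t = polyn (taylor_coef f z 1) k (t * h).
Proof.
  apply sum_eq. intros l _. unfold taylor_coef.
  rewrite Rpow_mult_distr, pow1. ring.
Qed.

Lemma Derive_n_Derive f k x : Derive_n (Derive f) k x = Derive_n f (S k) x.
Proof.
  replace (S k) with (k + 1)%nat by lia. rewrite <- Derive_n_comp. reflexivity.
Qed.

Lemma is_derive_shift f z x :
  ex_derive f (z + x) -> is_derive (fun v => f (z + v)) x (Derive f (z + x)).
Proof.
  intros Hf. rewrite <- (Rmult_1_l (Derive f (z + x))).
  apply (is_derive_comp f (fun v => z + v)).
  - now apply Derive_correct.
  - auto_derive; [exact I|]. reflexivity.
Qed.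

Lemma mean_value_bound g dg N u :
  (forall x, Rabs x <= Rabs u -> is_derive g x (dg x)) ->
  (forall x, Rabs x <= Rabs u -> Rabs (dg x) <= N) ->
  g 0 = 0 -> Rabs (g u) <= N * Rabs u.
Proof.
  intros Hd HN H0.
  destruct (MVT_cor4 g dg 0 (Rabs u)) with (b := u) as (x & Hx & Hxu).
  - intros x Hx. apply Hd. now rewrite Rminus_0_r in Hx.
  - rewrite Rminus_0_r. lra.
  - rewrite !Rminus_0_r in *. rewrite H0, Rminus_0_r in Hx. rewrite Hx, Rabs_mult.
    apply Rmult_le_compat_r; [apply Rabs_pos|auto].
Qed.

(** Unlike Lagrange's form on an interval, this holds on both sides of [z].
    The derivative of the remainder is the remainder of the derivative. *)
Lemma taylor_remainder_bound k f z d M :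
  (forall y, Rabs (y - z) < d -> forall j, (j <= S k)%nat -> ex_derive_n f j y) ->
  (forall y, Rabs (y - z) < d -> Rabs (Derive_n f (S k) y) <= M) ->
  forall u, Rabs u < d ->
    Rabs (f (z + u) - polyn (taylor_coef f z 1) k u) <= M * Rabs u ^ S k.
Proof.
  revert f. induction k as [|k IH]; intros f Hex HM u Hu.
  - replace (M * Rabs u ^ 1) with (M * Rabs u) by ring.
    replace (f (z + u) - polyn (taylor_coef f z 1) 0 u) with (f (z + u) - f z)
      by (unfold polyn, taylor_coef; simpl; field).
    apply (mean_value_bound (fun v => f (z + v) - f z) (fun v => Derive f (z + v))).
    + intros x Hx.
      assert (Hfx : ex_derive f (z + x)).
      { apply (Hex (z + x)) with (j := 1%nat); [|lia].
        replace (z + x - z) with x by ring. lra. }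
      rewrite <- (Rminus_0_r (Derive f (z + x))).
      apply @is_derive_minus; [now apply is_derive_shift|].
      apply @is_derive_const.
    + intros x Hx. apply (HM (z + x)). replace (z + x - z) with x by ring. lra.
    + rewrite Rplus_0_r. lra.
  - rewrite <- tech_pow_Rmult, (Rmult_comm (Rabs u)), <- Rmult_assoc.
    apply (mean_value_bound
      (fun v => f (z + v) - polyn (taylor_coef f z 1) (S k) v)
      (fun v => Derive f (z + v) - polyn (taylor_coef (Derive f) z 1) k v)).
    + intros x Hx. apply @is_derive_minus.
      * assert (Hfx : ex_derive f (z + x)).
        { apply (Hex (z + x)) with (j := 1%nat); [|lia].
          replace (z + x - z) with x by ring. lra. }
        now apply is_derive_shift.
      * rewrite (poly_ext _ (fun l => INR (S l) * taylor_coef f z 1 (S l))).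
        { apply is_derive_poly. }
        intros l _. unfold taylor_coef. rewrite Derive_n_Derive, fact_simpl, mult_INR, !pow1.
        field. split; [apply INR_fact_neq_0|apply not_0_INR; lia].
    + intros x Hx.
      apply Rle_trans with (M * Rabs x ^ S k).
      * apply IH; [| |lra].
        { intros y Hy [|j] Hj; [exact I|].
          apply (ex_derive_ext (Derive_n f (S j))).
          - intros; symmetry; apply Derive_n_Derive.
          - apply (Hex y Hy (S (S j))). lia. }
        { intros y Hy. rewrite Derive_n_Derive. now apply HM. }
      * apply Rmult_le_compat_l.
        { eapply Rle_trans; [apply Rabs_pos|apply (HM z)].
          rewrite Rminus_diag, Rabs_R0. pose proof (Rabs_pos u). lra. }
        apply pow_incr. split; [apply Rabs_pos|exact Hx].
    + rewrite Rplus_0_r, poly_coef0. unfold taylor_coef. simpl. field.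
Qed.

Lemma ball_R (x e y : R) : ball x e y <-> Rabs (y - x) < e.
Proof. reflexivity. Qed.

Lemma C_near_bounded n k f z :
  C_near n f z -> (k <= n)%nat ->
  exists d M, 0 < d /\ 0 <= M /\ forall y, Rabs (y - z) < d ->
    (forall j, (j <= n)%nat -> ex_derive_n f j y) /\ Rabs (Derive_n f k y) <= M.
Proof.
  intros Hf Hk.
  assert (Hcont : continuous (Derive_n f k) z).
  { destruct (locally_singleton _ _ Hf) as (Hex & Hc).
    destruct (Nat.eq_dec k n) as [->|]; [exact Hc|].
    apply @ex_derive_continuous. apply (Hex (S k)). lia. }
  assert (Hloc : locally z (fun y => ball (Derive_n f k z) 1 (Derive_n f k y))).
  { exact (proj1 (filterlim_locally _ _) Hcont (mkposreal 1 Rlt_0_1)). }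
  destruct (filter_and _ _ Hf Hloc) as (d & Hd).
  exists d, (Rabs (Derive_n f k z) + 1). split; [apply cond_pos|].
  split; [pose proof (Rabs_pos (Derive_n f k z)); lra|].
  intros y Hy. destruct (Hd y Hy) as ((Hex & _) & Hb). split; [exact Hex|].
  apply (proj1 (ball_R _ _ _)) in Hb.
  replace (Derive_n f k y) with (Derive_n f k z + (Derive_n f k y - Derive_n f k z)) by ring.
  eapply Rle_trans; [apply Rabs_triang|]. lra.
Qed.

Lemma at_right_lt d : 0 < d -> at_right 0 (fun h => 0 < h < d).
Proof.
  intros Hd. exists (mkposreal d Hd). intros h Hh Hpos.
  apply (proj1 (ball_R _ _ _)) in Hh. rewrite Rminus_0_r in Hh. simpl in Hh.
  rewrite Rabs_right in Hh; lra.
Qed.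

Lemma at_right_delta (P : R -> Prop) :
  at_right 0 P -> exists d, 0 < d /\ forall h, 0 < h < d -> P h.
Proof.
  intros (d & Hd). exists d. split; [apply cond_pos|].
  intros h Hh. apply Hd; [|lra]. apply (proj2 (ball_R _ _ _)). rewrite Rminus_0_r, Rabs_right; lra.
Qed.

(** Bounds obtained for one substencil at a time get a common constant.  Lower
    bounds fit in as well, in the form [x <= C y]. *)
Lemma eventually_uniform N (P : nat -> R -> R -> Prop) :
  (forall i C C' h, C <= C' -> P i C h -> P i C' h) ->
  (forall i, (i <= N)%nat -> exists C, at_right 0 (P i C)) ->
  exists C, 0 < C /\ at_right 0 (fun h => forall i, (i <= N)%nat -> P i C h).
Proof.
  intros Hmono. induction N as [|N IH]; intros H.
  - destruct (H 0%nat ltac:(lia)) as (C & HC).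
    exists (Rabs C + 1). split; [pose proof (Rabs_pos C); lra|].
    revert HC. apply filter_imp. intros h Hh i Hi.
    replace i with 0%nat by lia. apply Hmono with C; [|exact Hh].
    pose proof (Rle_abs C). lra.
  - destruct IH as (C1 & HC1 & H1); [intros; apply H; lia|].
    destruct (H (S N) ltac:(lia)) as (C2 & H2).
    exists (Rmax C1 C2). split; [pose proof (Rmax_l C1 C2); lra|].
    generalize (filter_and _ _ H1 H2). apply filter_imp. intros h (Ha & Hb) i Hi.
    destruct (Nat.eq_dec i (S N)) as [->|].
    + apply Hmono with C2; [apply Rmax_r|exact Hb].
    + apply Hmono with C1; [apply Rmax_l|apply Ha; lia].
Qed.

Lemma taylor_rescaled n k f z B :
  C_near n f z -> (S k <= n)%nat -> 1 <= B ->
  exists C, 0 <= C /\ at_right 0 (fun h => forall t, Rabs t <= B ->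
    continuous f (z + t * h) /\
    Rabs (f (z + t * h) - polyn (taylor_coef f z h) k t) <= C * h ^ S k).
Proof.
  intros Hf Hk HB. destruct (C_near_bounded n (S k) f z Hf Hk) as (d & M & Hd & HM & H).
  exists (M * B ^ S k). split; [apply Rmult_le_pos; [exact HM|apply pow_le; lra]|].
  assert (HdB : 0 < d / B) by (apply Rdiv_lt_0_compat; lra).
  generalize (at_right_lt _ HdB). apply filter_imp. intros h Hh t Ht.
  assert (Hth : Rabs (t * h) <= B * h).
  { rewrite Rabs_mult, (Rabs_right h) by lra. apply Rmult_le_compat_r; lra. }
  assert (HBh : B * h < d).
  { apply Rmult_lt_reg_l with (/ B); [apply Rinv_0_lt_compat; lra|].
    rewrite <- Rmult_assoc, Rinv_l by lra. unfold Rdiv in Hh. lra. }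
  assert (Hball : Rabs (z + t * h - z) < d) by (replace (z + t * h - z) with (t * h) by ring; lra).
  split.
  - apply @ex_derive_continuous. apply (proj1 (H _ Hball) 1%nat). lia.
  - rewrite taylor_coef_scale.
    eapply Rle_trans.
    + apply (taylor_remainder_bound k f z d M); [| |lra].
      * intros y Hy j Hj. apply (H y Hy). lia.
      * intros y Hy. apply (H y Hy).
    + rewrite Rmult_assoc, <- Rpow_mult_distr.
      apply Rmult_le_compat_l; [exact HM|].
      apply pow_incr. split; [apply Rabs_pos|exact Hth].
Qed.

(** * Powers and weights *)

Lemma rpow_nonneg a s : 0 <= rpow a s.
Proof.
  unfold rpow. destruct (Rlt_dec 0 a); [|lra].
  apply Rlt_le, exp_pos.
Qed.

Lemma rpow_mono a b s : 0 <= s -> a <= b -> rpow a s <= rpow b s.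
Proof.
  intros Hs Hab. unfold rpow at 1. destruct (Rlt_dec 0 a) as [Ha|]; [|apply rpow_nonneg].
  unfold rpow. destruct (Rlt_dec 0 b); [|lra]. apply Rle_Rpower_l; lra.
Qed.

Lemma rpow_mult a b s : 0 <= a -> 0 <= b -> rpow (a * b) s = rpow a s * rpow b s.
Proof.
  intros [Ha|<-] [Hb|<-]; unfold rpow.
  - destruct (Rlt_dec 0 a), (Rlt_dec 0 b), (Rlt_dec 0 (a * b)); try nra.
    symmetry. now apply Rpower_mult_distr.
  - rewrite Rmult_0_r. destruct (Rlt_dec 0 0); [lra|ring].
  - rewrite Rmult_0_l. destruct (Rlt_dec 0 0); [lra|ring].
  - rewrite Rmult_0_l. destruct (Rlt_dec 0 0); [lra|ring].
Qed.

Lemma rpow_square_le h s k : 0 < h < 1 -> INR k / 2 <= s -> rpow (h ^ 2) s <= h ^ k.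
Proof.
  intros Hh Hk. unfold rpow. destruct (Rlt_dec 0 (h ^ 2)) as [_|]; [|apply pow_le; lra].
  rewrite <- (Rpower_pow k) by lra. rewrite <- (Rpower_pow 2) by lra.
  rewrite Rpower_mult. unfold Rpower.
  assert (Hln : ln h < 0) by (rewrite <- ln_1; apply ln_increasing; lra).
  destruct (Req_dec (INR 2 * s) (INR k)) as [->|Hne]; [lra|].
  apply Rlt_le, exp_increasing. simpl (INR 2) in *. nra.
Qed.

(** This is where the lower bound on the exponent enters: a factor [h ^ 2]
    between two indicators makes a factor [h ^ k] between their powers. *)
Lemma rpow_indicator_ratio d I K h s k :
  0 < h < 1 -> INR k / 2 <= s -> 0 <= K -> 0 <= I -> d <= K * h ^ 2 * I ->
  rpow d s <= rpow K s * h ^ k * rpow I s.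
Proof.
  intros Hh Hk HK HI Hd.
  assert (Hs : 0 <= s) by (pose proof (pos_INR k); lra).
  assert (Hh2 : 0 <= h ^ 2) by (apply pow_le; lra).
  eapply Rle_trans; [apply rpow_mono; [exact Hs|exact Hd]|].
  rewrite !rpow_mult by nra.
  apply Rmult_le_compat_r; [apply rpow_nonneg|].
  apply Rmult_le_compat_l; [apply rpow_nonneg|]. now apply rpow_square_le.
Qed.

Lemma sum_nonneg (u : nat -> R) N : (forall i, (i <= N)%nat -> 0 <= u i) -> 0 <= sum_f_R0 u N.
Proof.
  intros H. replace 0 with (sum_f_R0 (fun _ => 0) N) by (rewrite sum_cte; ring).
  now apply sum_Rle.
Qed.

Lemma sum_ge_term (u : nat -> R) N i :
  (forall i, (i <= N)%nat -> 0 <= u i) -> (i <= N)%nat -> u i <= sum_f_R0 u N.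
Proof.
  intros Hu Hi. induction N as [|N IH].
  - replace i with 0%nat by lia. simpl. lra.
  - simpl. destruct (Nat.eq_dec i (S N)) as [->|].
    + pose proof (sum_nonneg u N ltac:(intros; apply Hu; lia)). lra.
    + pose proof (IH ltac:(intros; apply Hu; lia) ltac:(lia)). pose proof (Hu (S N) ltac:(lia)). lra.
Qed.

Lemma sum_le_const (u : nat -> R) N M :
  (forall i, (i <= N)%nat -> u i <= M) -> sum_f_R0 u N <= INR (S N) * M.
Proof.
  intros Hu. rewrite Rmult_comm, <- sum_cte. now apply sum_Rle.
Qed.

Lemma pow_antitone h a b : 0 <= h <= 1 -> (a <= b)%nat -> h ^ b <= h ^ a.
Proof.
  intros Hh Hab. replace b with (a + (b - a))%nat by lia. rewrite pow_add.
  rewrite <- (Rmult_1_r (h ^ a)) at 2. apply Rmult_le_compat_l; [apply pow_le; lra|].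
  rewrite <- (pow1 (b - a)). now apply pow_incr.
Qed.

Section Weights.

Variables (n : nat) (s eps d : R) (I : nat -> R).
Hypothesis eps_pos : 0 < eps.

Let den i := rpow (I i) s + eps.
Let w := global_weight n s eps d I.
Let lw := local_weight n s eps d I.

Lemma den_pos i : 0 < den i.
Proof. unfold den. pose proof (rpow_nonneg (I i) s). lra. Qed.

Lemma inv_den_pos i : 0 < / den i.
Proof. apply Rinv_0_lt_compat, den_pos. Qed.

Lemma alpha_pos i : 0 < alpha n s eps d I i.
Proof.
  unfold alpha. apply Rmult_lt_0_compat.
  - apply Rinv_0_lt_compat, lt_0_INR. lia.
  - pose proof (rpow_nonneg d s). pose proof (inv_den_pos i). fold (den i).
    unfold Rdiv. nra.
Qed.

Lemma sum_alpha_pos : 0 < sum_f_R0 (alpha n s eps d I) (rhigh n).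
Proof.
  apply Rlt_le_trans with (alpha n s eps d I 0); [apply alpha_pos|].
  apply sum_ge_term; [|lia]. intros i _. apply Rlt_le, alpha_pos.
Qed.

Lemma local_weight_nonneg i : 0 <= lw i.
Proof.
  apply Rlt_le, Rdiv_lt_0_compat; [apply alpha_pos|apply sum_alpha_pos].
Qed.

Lemma sum_local_weight : sum_f_R0 lw (rhigh n) = 1.
Proof.
  unfold lw, local_weight, Rdiv. rewrite <- scal_sum, Rmult_comm.
  apply Rinv_r. pose proof sum_alpha_pos. lra.
Qed.

Lemma J_sum_nonneg : 0 <= J_sum n s eps I.
Proof. apply sum_nonneg. intros i _. apply Rlt_le, inv_den_pos. Qed.

Lemma global_weight_bounds : 0 <= w <= 1.
Proof.
  unfold w, global_weight. pose proof J_sum_nonneg. pose proof (rpow_nonneg d s).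
  assert (H1 : 1 <= 1 + rpow d s * J_sum n s eps I) by nra.
  split; [apply Rlt_le, Rinv_0_lt_compat; lra|].
  rewrite <- Rinv_1. apply Rinv_le_contravar; lra.
Qed.

Lemma weno_error_le P p F :
  Rabs (weno_combination n s eps d I P p - F) <=
  w * Rabs (p - F) + (1 - w) * sum_f_R0 (fun i => lw i * Rabs (P i - F)) (rhigh n).
Proof.
  pose proof global_weight_bounds as Hw. fold w in Hw.
  assert (Hsum : sum_f_R0 (fun i => lw i * P i) (rhigh n) - F =
    sum_f_R0 (fun i => lw i * (P i - F)) (rhigh n)).
  { replace F with (sum_f_R0 (fun i => lw i * F) (rhigh n)) at 1.
    - rewrite <- minus_sum. apply sum_eq. intros; ring.
    - rewrite <- scal_sum, sum_local_weight. ring. }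
  unfold weno_combination. fold w. fold lw.
  replace (w * p + (1 - w) * sum_f_R0 (fun i => lw i * P i) (rhigh n) - F)
    with (w * (p - F) + (1 - w) * (sum_f_R0 (fun i => lw i * P i) (rhigh n) - F)) by ring.
  rewrite Hsum. eapply Rle_trans; [apply Rabs_triang|].
  rewrite !Rabs_mult, (Rabs_right w), (Rabs_right (1 - w)) by lra.
  apply Rplus_le_compat_l, Rmult_le_compat_l; [lra|].
  eapply Rle_trans; [apply Rsum_abs|]. apply Req_le, sum_eq. intros i _.
  rewrite Rabs_mult, (Rabs_right (lw i)); [reflexivity|apply Rle_ge, local_weight_nonneg].
Qed.

Lemma weno_error_convex P p F E E' :
  Rabs (p - F) <= E -> (forall i, (i <= rhigh n)%nat -> Rabs (P i - F) <= E') ->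
  Rabs (weno_combination n s eps d I P p - F) <= w * E + (1 - w) * E'.
Proof.
  intros HE HE'. pose proof global_weight_bounds as Hw. fold w in Hw.
  eapply Rle_trans; [apply weno_error_le|].
  apply Rplus_le_compat; apply Rmult_le_compat_l; try lra.
  replace E' with (sum_f_R0 (fun i => lw i * E') (rhigh n))
    by (rewrite <- scal_sum, sum_local_weight; ring).
  apply sum_Rle. intros i Hi. apply Rmult_le_compat_l; [apply local_weight_nonneg|auto].
Qed.

(** With [1 - w = d^s J / (1 + d^s J) <= d^s J], uniformly in [eps]. *)
Lemma global_weight_near_1 K :
  (forall i, (i <= rhigh n)%nat -> rpow d s <= K * rpow (I i) s) -> 0 <= K ->
  1 - w <= INR (S (rhigh n)) * K.
Proof.
  intros HK HK0. unfold w, global_weight.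
  pose proof J_sum_nonneg as HJ. pose proof (rpow_nonneg d s) as HD.
  assert (HDJ : rpow d s * J_sum n s eps I <= INR (S (rhigh n)) * K).
  { unfold J_sum. rewrite scal_sum. apply sum_le_const. intros i Hi.
    pose proof (den_pos i) as Hd. fold (den i). apply Rmult_le_reg_l with (den i); [exact Hd|].
    rewrite <- Rmult_assoc, Rinv_r, Rmult_1_l by lra.
    eapply Rle_trans; [apply HK, Hi|]. unfold den. nra. }
  assert (H0 : 0 <= rpow d s * J_sum n s eps I) by nra.
  apply Rle_trans with (rpow d s * J_sum n s eps I); [|exact HDJ].
  apply Rmult_le_reg_r with (1 + rpow d s * J_sum n s eps I); [lra|].
  rewrite Rmult_minus_distr_r, Rinv_l by lra. nra.
Qed.

(** A substencil [i0] free of the jump takes almost all the weight: both the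
    global reconstruction and the substencils on which the indicator stays
    away from zero are suppressed by the factor [den i0]. *)
Lemma weno_error_jump P p F i0 K E G :
  (i0 <= rhigh n)%nat -> 0 <= K -> 0 <= E -> 1 <= K * rpow d s -> Rabs (p - F) <= G ->
  (forall i, (i <= rhigh n)%nat ->
     Rabs (P i - F) <= E \/ (1 <= K * rpow (I i) s /\ Rabs (P i - F) <= G)) ->
  Rabs (weno_combination n s eps d I P p - F) <=
  INR (S (rhigh n)) * E + (2 * INR (S (rhigh n)) + 1) * (K * G) * (rpow (I i0) s + eps).
Proof.
  intros Hi0 HK HE Hd HG HP. fold (den i0).
  pose proof global_weight_bounds as Hw. fold w in Hw.
  pose proof (den_pos i0) as Hden0. pose proof (rpow_nonneg d s) as HD.
  assert (HDpos : 0 < rpow d s) by nra.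
  assert (HKpos : 0 < K) by nra.
  assert (HG0 : 0 <= G) by (pose proof (Rabs_pos (p - F)); lra).
  assert (HinvD : / rpow d s <= K).
  { apply Rmult_le_reg_r with (rpow d s); [exact HDpos|]. rewrite Rinv_l; lra. }
  assert (HwK : w <= K * den i0).
  { assert (HJ : / den i0 <= J_sum n s eps I).
    { apply (sum_ge_term (fun i => / den i)); [|exact Hi0].
      intros i _. apply Rlt_le, inv_den_pos. }
    pose proof (inv_den_pos i0) as Hinv0.
    unfold w, global_weight.
    apply Rle_trans with (/ (rpow d s * / den i0)).
    - apply Rinv_le_contravar; [nra|]. nra.
    - rewrite Rinv_mult, Rinv_inv. nra. }
  assert (Hlw : forall i, (i <= rhigh n)%nat ->
    lw i * Rabs (P i - F) <= E + 2 * (K * G) * den i0).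
  { intros i Hi.
    assert (Hlw0 := local_weight_nonneg i). fold lw in Hlw0.
    assert (Hlw1 : lw i <= 1).
    { rewrite <- sum_local_weight. apply sum_ge_term; [|exact Hi].
      intros; apply local_weight_nonneg. }
    assert (0 <= (K * G) * den i0) by (apply Rmult_le_pos; nra).
    destruct (HP i Hi) as [HPE|(HIi & HPG)].
    { pose proof (Rabs_pos (P i - F)). nra. }
    assert (Hlwi : lw i <= 2 * K * den i0).
    { assert (HIpos : 0 < rpow (I i) s) by (pose proof (rpow_nonneg (I i) s); nra).
      pose proof (den_pos i) as Hden. pose proof (inv_den_pos i0) as Hinv0.
      assert (HinvI : / den i <= K).
      { apply Rle_trans with (/ rpow (I i) s).
        - apply Rinv_le_contravar; [exact HIpos|unfold den; lra].
        - apply Rmult_le_reg_r with (rpow (I i) s); [exact HIpos|]. rewrite Rinv_l; lra. }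
      pose proof (alpha_pos i0) as Ha0. pose proof sum_alpha_pos as HS.
      apply Rle_trans with (alpha n s eps d I i / alpha n s eps d I i0).
      - apply Rmult_le_compat_l; [apply Rlt_le, alpha_pos|].
        apply Rinv_le_contravar; [exact Ha0|].
        apply sum_ge_term; [|exact Hi0]. intros; apply Rlt_le, alpha_pos.
      - assert (HN : 0 < / INR (rhigh n + 1)) by (apply Rinv_0_lt_compat, lt_0_INR; lia).
        apply Rmult_le_reg_r with (alpha n s eps d I i0); [exact Ha0|].
        unfold Rdiv. rewrite Rmult_assoc, Rinv_l, Rmult_1_r by lra.
        unfold alpha. fold (den i) (den i0). unfold Rdiv.
        apply Rle_trans with
          (/ INR (rhigh n + 1) * (2 * K * den i0 * (rpow d s * / den i0))).
        + apply Rmult_le_compat_l; [lra|].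
          replace (2 * K * den i0 * (rpow d s * / den i0)) with (2 * (K * rpow d s))
            by (field; lra). nra.
        + rewrite <- Rmult_assoc, (Rmult_comm (/ _)), Rmult_assoc.
          apply Rmult_le_compat_l; [nra|]. apply Rmult_le_compat_l; nra. }
    apply Rle_trans with (2 * K * den i0 * G); [|lra].
    apply Rmult_le_compat; auto using Rabs_pos. }
  eapply Rle_trans; [apply weno_error_le|].
  assert (Hsum := sum_le_const _ _ _ Hlw).
  assert (Hsum0 : 0 <= sum_f_R0 (fun i => lw i * Rabs (P i - F)) (rhigh n)).
  { apply sum_nonneg. intros i _. apply Rmult_le_pos; [apply local_weight_nonneg|apply Rabs_pos]. }
  assert (Hw1 : w * Rabs (p - F) <= K * den i0 * G)
    by (apply Rmult_le_compat; [lra|apply Rabs_pos|lra|lra]).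
  assert (Hw2 : (1 - w) * sum_f_R0 (fun i => lw i * Rabs (P i - F)) (rhigh n) <=
    sum_f_R0 (fun i => lw i * Rabs (P i - F)) (rhigh n)) by nra.
  lra.
Qed.

End Weights.

(** [g] is shared out in proportion to the two terms of its bound. *)
Lemma bigO_of_sum_bound k g :
  (exists C, at_right 0 (fun h => forall eps, 0 < eps -> Rabs (g h eps) <= C * (h ^ k + eps))) ->
  bigO_h_eps k g.
Proof.
  intros (C & HC). apply at_right_delta in HC. destruct HC as (d & Hd & H).
  exists (fun h eps => g h eps * (h ^ k / (h ^ k + eps))),
         (fun h eps => g h eps * (eps / (h ^ k + eps))).
  assert (Hpos : forall h eps, 0 < h -> 0 < eps -> 0 < h ^ k + eps).
  { intros h eps Hh Heps. pose proof (pow_lt h k Hh). lra. }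
  split.
  { intros h eps Hh Heps. pose proof (Hpos h eps Hh Heps). field. lra. }
  exists C, d. split; [exact Hd|]. intros h eps Hh Heps.
  specialize (H h Hh eps ltac:(lra)). specialize (Hpos h eps ltac:(lra) ltac:(lra)).
  assert (Hinv := Rinv_0_lt_compat _ Hpos).
  assert (Hhk : 0 < h ^ k) by (apply pow_lt; lra).
  assert (Hpart : forall x, 0 <= x -> Rabs (g h eps * (x / (h ^ k + eps))) <= C * x).
  { intros x Hx. rewrite Rabs_mult, (Rabs_right (x / _))
      by (apply Rle_ge, Rmult_le_pos; lra).
    replace (C * x) with (C * (h ^ k + eps) * (x / (h ^ k + eps))) by (field; lra).
    apply Rmult_le_compat_r; [apply Rmult_le_pos; lra|exact H]. }
  split; apply Hpart; lra.
Qed.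

(** * Data on the rescaled stencil *)

(** The datum of index [j] on the stencil of size 1 at the origin.  With
    [x = z + t h] the data of [f] become samples of [t |-> f (z + t h)] on a
    stencil that does not depend on [h]. *)
Definition sample (fw : framework) (c : nat -> R) (g : R -> R) (j : nat) : R :=
  match fw with
  | point_values => g (c j)
  | cell_averages => RInt g (c j) (c (S j)) / (c (S j) - c j)
  end.

(** Where a mean value theorem finds the datum of index [j].  Cells are open
    here, so that such points increase strictly with [j]. *)
Definition inside (fw : framework) (c : nat -> R) (j : nat) (t : R) : Prop :=
  match fw with
  | point_values => t = c j
  | cell_averages => c j < t < c (S j)
  end.

Section Sampling.

Variables (fw : framework) (n : nat) (c : nat -> R) (B : R).
Hypothesis n_ge3 : (3 <= n)%nat.
Hypothesis c_incr : increasing_nodes fw n c.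
Hypothesis c_bound : forall i, (i <= last_node fw n)%nat -> Rabs (c i) <= B.

Lemma sample_ext g g' j : (forall t, g t = g' t) -> sample fw c g j = sample fw c g' j.
Proof.
  intros H. unfold sample. destruct fw; [apply H|].
  f_equal. apply RInt_ext. intros; apply H.
Qed.

Lemma cell_bound j t :
  fw = cell_averages -> (j <= n - 1)%nat -> c j <= t <= c (S j) -> Rabs t <= B.
Proof.
  intros E Hj Ht. rewrite E in c_bound. unfold last_node in c_bound.
  pose proof (c_bound j ltac:(lia)) as H1. pose proof (c_bound (S j) ltac:(lia)) as H2.
  apply Rabs_le_between in H1, H2. apply Rabs_le_between. lra.
Qed.

Lemma cell_pos j :
  fw = cell_averages -> (j <= n - 1)%nat -> c j < c (S j).
Proof.
  intros E Hj. apply c_incr. rewrite E. unfold last_node. lia.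
Qed.

Lemma ex_RInt_cell (g : R -> R) j :
  fw = cell_averages -> (j <= n - 1)%nat ->
  (forall t, Rabs t <= B -> continuous g t) -> ex_RInt g (c j) (c (S j)).
Proof.
  intros E Hj Hg. pose proof (cell_pos j E Hj).
  apply @ex_RInt_continuous. rewrite Rmin_left, Rmax_right by lra.
  intros t Ht. apply Hg. now apply (cell_bound j).
Qed.

Lemma sample_affine (g : R -> R) u v j :
  (j <= n - 1)%nat -> (forall t, Rabs t <= B -> continuous g t) ->
  sample fw c (fun t => u + v * g t) j = u + v * sample fw c g j.
Proof.
  intros Hj Hg. unfold sample. destruct fw eqn:E; [reflexivity|].
  assert (Hint : ex_RInt g (c j) (c (S j))) by (rewrite <- E in *; now apply ex_RInt_cell).
  assert (Hpos : c j < c (S j)) by (rewrite <- E in *; now apply cell_pos).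
  replace (RInt (fun t => u + v * g t) (c j) (c (S j)))
    with (u * (c (S j) - c j) + v * RInt g (c j) (c (S j))); [field; lra|].
  symmetry. apply is_RInt_unique.
  replace (u * (c (S j) - c j)) with (scal (c (S j) - c j) u) by (unfold scal; simpl; unfold mult; simpl; ring).
  apply (is_RInt_plus (fun _ => u) (fun t => v * g t)).
  - apply (is_RInt_const (c j) (c (S j)) u).
  - apply (is_RInt_scal g). now apply @RInt_correct.
Qed.

Lemma sample_minus (g g' : R -> R) j :
  (j <= n - 1)%nat ->
  (forall t, Rabs t <= B -> continuous g t) ->
  (forall t, Rabs t <= B -> continuous g' t) ->
  sample fw c g j - sample fw c g' j = sample fw c (fun t => g t - g' t) j.
Proof.
  intros Hj Hg Hg'. unfold sample. destruct fw eqn:E; [reflexivity|].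
  rewrite <- E in *.
  pose proof (cell_pos j E Hj) as Hpos.
  assert (Hminus : RInt (fun t => g t - g' t) (c j) (c (S j)) =
    RInt g (c j) (c (S j)) - RInt g' (c j) (c (S j)))
    by (apply (RInt_minus g g'); now apply ex_RInt_cell).
  rewrite Hminus. field. lra.
Qed.

Lemma sample_bound (g : R -> R) M j :
  (j <= n - 1)%nat -> (forall t, Rabs t <= B -> continuous g t) ->
  (forall t, Rabs t <= B -> Rabs (g t) <= M) -> Rabs (sample fw c g j) <= M.
Proof.
  intros Hj Hg HM. unfold sample. destruct fw eqn:E.
  - apply HM, c_bound. unfold last_node. lia.
  - rewrite <- E in *. pose proof (cell_pos j E Hj) as Hpos.
    unfold Rdiv. rewrite Rabs_mult, (Rabs_right (/ _))
      by (apply Rle_ge, Rlt_le, Rinv_0_lt_compat; lra).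
    apply Rmult_le_reg_r with (c (S j) - c j); [lra|].
    rewrite Rmult_assoc, Rinv_l, Rmult_1_r, Rmult_comm by lra.
    apply abs_RInt_le_const; [lra|now apply ex_RInt_cell|].
    intros t Ht. apply HM. now apply (cell_bound j).
Qed.

Lemma sample_dist (g g' : R -> R) M j :
  (j <= n - 1)%nat ->
  (forall t, Rabs t <= B -> continuous g t) ->
  (forall t, Rabs t <= B -> continuous g' t) ->
  (forall t, Rabs t <= B -> Rabs (g t - g' t) <= M) ->
  Rabs (sample fw c g j - sample fw c g' j) <= M.
Proof.
  intros Hj Hg Hg' HM. rewrite sample_minus by assumption.
  apply sample_bound; auto.
  intros t Ht. apply @continuous_minus; auto.
Qed.

Lemma average_poly a k x y :
  RInt (polyn a k) x y = polyn (primitive_coef a) (S k) y - polyn (primitive_coef a) (S k) x.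
Proof.
  apply is_RInt_unique, @is_RInt_derive.
  - intros; apply is_derive_primitive.
  - intros; apply continuous_poly.
Qed.

Lemma sample_poly_mean a k j :
  (j <= n - 1)%nat -> exists t, inside fw c j t /\ sample fw c (polyn a k) j = polyn a k t.
Proof.
  intros Hj. unfold sample, inside. destruct fw eqn:E.
  - exists (c j). auto.
  - rewrite <- E in *. pose proof (cell_pos j E Hj) as Hpos.
    destruct (MVT_cor2 (polyn (primitive_coef a) (S k)) (polyn a k) _ _ Hpos) as (t & Ht & Hin).
    + intros t _. apply is_derive_Reals, is_derive_primitive.
    + exists t. split; [exact Hin|]. rewrite average_poly, Ht. field. lra.
Qed.

Lemma inside_lt i j x y :
  (i < j <= n - 1)%nat -> inside fw c i x -> inside fw c j y -> x < y.
Proof.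
  unfold inside. intros Hij. unfold increasing_nodes, last_node in c_incr.
  destruct fw; intros Hx Hy.
  - subst. apply c_incr. lia.
  - destruct (Nat.eq_dec (S i) j) as [<-|Hne]; [lra|].
    pose proof (c_incr (S i) j ltac:(lia)). lra.
Qed.

(** Cell averages reduce to point values: the partial sums of the data, weighted
    by the lengths of the cells, are the values at the interfaces of a primitive,
    to which [interpolation_stable] applies. *)
Lemma sample_stable i k :
  (i + k <= n - 1)%nat ->
  exists C, 0 <= C /\ forall a M,
    (forall j, (i <= j <= i + k)%nat -> Rabs (sample fw c (polyn a k) j) <= M) ->
    forall l, (l <= k)%nat -> Rabs (a l) <= C * M.
Proof.
  intros Hik. unfold sample.
  unfold increasing_nodes, last_node in c_incr, c_bound. destruct fw.
  - destruct (interpolation_stable k (fun j => c (i + j)%nat)) as (C & HC & HS).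
    { intros p q Hpq. apply c_incr. lia. }
    exists C. split; [exact HC|]. intros a M H. apply HS.
    intros j Hj. apply H. lia.
  - destruct (interpolation_stable (S k) (fun j => c (i + j)%nat)) as (C & HC & HS).
    { intros p q Hpq. apply c_incr. lia. }
    assert (HB : 0 <= B).
    { pose proof (c_bound 0%nat ltac:(lia)). pose proof (Rabs_pos (c 0%nat)). lra. }
    exists (INR (S k) * (C * (2 * B))).
    assert (Hk := pos_INR (S k)).
    split; [apply Rmult_le_pos; nra|].
    intros a M H l Hl.
    (* The primitive that vanishes at [c i]. *)
    set (A := fun l => match l with
        | O => - polyn (primitive_coef a) (S k) (c i) | _ => primitive_coef a l end).
    assert (HA : forall x, polyn A (S k) x =
      polyn (primitive_coef a) (S k) x - polyn (primitive_coef a) (S k) (c i)).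
    { intros x. rewrite poly_head, (poly_head (primitive_coef a) k x).
      change (polyn (fun l => A (S l)) k x) with (polyn (fun l => primitive_coef a (S l)) k x).
      simpl. ring. }
    assert (HM : 0 <= M).
    { eapply Rle_trans; [apply Rabs_pos|apply (H i); lia]. }
    assert (Hsum : forall j, (j <= S k)%nat ->
      Rabs (polyn A (S k) (c (i + j)%nat)) <= M * (c (i + j)%nat - c i)).
    { induction j as [|j IH]; intros Hj.
      - rewrite Nat.add_0_r, HA, !Rminus_diag, Rabs_R0. lra.
      - specialize (IH ltac:(lia)). specialize (H (i + j)%nat ltac:(lia)).
        rewrite average_poly in H. rewrite HA in *.
        rewrite <- plus_n_Sm in *.
        pose proof (c_incr (i + j)%nat (S (i + j)) ltac:(lia)) as Hlt.
        set (u := polyn (primitive_coef a) (S k) (c (S (i + j)))) in *.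
        set (v := polyn (primitive_coef a) (S k) (c (i + j)%nat)) in *.
        unfold Rdiv in H. rewrite Rabs_mult, (Rabs_right (/ _)) in H
          by (apply Rle_ge, Rlt_le, Rinv_0_lt_compat; lra).
        apply Rmult_le_compat_r with (r := c (S (i + j)) - c (i + j)%nat) in H; [|lra].
        rewrite Rmult_assoc, Rinv_l, Rmult_1_r in H by lra.
        replace (u - polyn (primitive_coef a) (S k) (c i))
          with ((u - v) + (v - polyn (primitive_coef a) (S k) (c i))) by ring.
        eapply Rle_trans; [apply Rabs_triang|]. lra. }
    assert (HS' : Rabs (A (S l)) <= C * (2 * B * M)).
    { apply HS; [|lia]. intros j Hj. eapply Rle_trans; [apply Hsum; exact Hj|].
      pose proof (c_bound i ltac:(lia)) as H1. pose proof (c_bound (i + j)%nat ltac:(lia)) as H2.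
      apply Rabs_le_between in H1, H2. nra. }
    change (A (S l)) with (a l / INR (S l)) in HS'.
    assert (HSl : 0 < INR (S l)) by (apply lt_0_INR; lia).
    replace (a l) with (INR (S l) * (a l / INR (S l))) by (field; lra).
    rewrite Rabs_mult, (Rabs_right (INR (S l))) by lra.
    assert (INR (S l) <= INR (S k)) by (apply le_INR; lia).
    replace (INR (S k) * (C * (2 * B)) * M) with (INR (S k) * (C * (2 * B * M))) by ring.
    apply Rmult_le_compat; auto using Rabs_pos; lra.
Qed.

Lemma sample_exists v :
  exists a, forall j, (j <= n - 1)%nat -> sample fw c (polyn a (n - 1)) j = v j.
Proof.
  unfold sample. unfold increasing_nodes, last_node in c_incr. destruct fw.
  - apply interpolation_exists, c_incr.
  - set (V := fix V j := match j with
        | O => 0 | S j' => V j' + v j' * (c (S j') - c j') end).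
    destruct (interpolation_exists n c V c_incr) as (a & Ha).
    exists (fun l => INR (S l) * a (S l)). intros j Hj.
    replace (RInt _ (c j) (c (S j))) with (polyn a n (c (S j)) - polyn a n (c j)).
    + rewrite !Ha by lia. simpl.
      pose proof (c_incr j (S j) ltac:(lia)). field. lra.
    + symmetry. apply is_RInt_unique.
      replace n with (S (n - 1)) at 2 3 by lia. apply @is_RInt_derive.
      * intros; apply is_derive_poly.
      * intros; apply continuous_poly.
Qed.

Hypothesis B_ge1 : 1 <= B.

Lemma continuous_rescale (g : R -> R) z h t :
  continuous g (z + t * h) -> continuous (fun t => g (z + t * h)) t.
Proof.
  intros Hg. apply (continuous_comp (fun t => z + t * h) g t); [|exact Hg].
  apply @ex_derive_continuous. auto_derive. exact I.
Qed.

Lemma data_sample (g : R -> R) z h j :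
  (j <= n - 1)%nat -> 0 < h ->
  (forall t, Rabs t <= B -> continuous g (z + t * h)) ->
  data fw c z g h j = sample fw c (fun t => g (z + t * h)) j.
Proof.
  intros Hj Hh Hg. unfold data, sample, node. destruct fw eqn:E; [reflexivity|].
  assert (Hpos : c j < c (S j)) by (rewrite <- E in *; now apply cell_pos).
  assert (Hex : ex_RInt (fun t => g (z + t * h)) (c j) (c (S j))).
  { rewrite <- E in *. apply ex_RInt_cell; auto.
    intros t Ht. apply continuous_rescale; auto. }
  assert (Hlin : RInt g (z + c j * h) (z + c (S j) * h) =
    h * RInt (fun t => g (z + t * h)) (c j) (c (S j))).
  { replace (z + c j * h) with (h * c j + z) by ring.
    replace (z + c (S j) * h) with (h * c (S j) + z) by ring.
    rewrite <- (RInt_comp_lin g).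
    - rewrite <- (RInt_scal (fun t => g (z + t * h))) by exact Hex.
      apply RInt_ext. intros x _. do 2 f_equal. ring.
    - apply @ex_RInt_continuous. intros x Hx.
      replace x with (z + (x - z) / h * h) by (field; lra).
      apply Hg. rewrite <- E in *.
      apply (cell_bound j); auto.
      rewrite Rmin_left, Rmax_right in Hx by nra.
      split; apply Rmult_le_reg_r with h; try lra;
        unfold Rdiv; rewrite Rmult_assoc, Rinv_l; lra. }
  rewrite Hlin. field. nra.
Qed.

Lemma reconstructs_rescaled f z h i k P :
  (i + k <= n - 1)%nat -> 0 < h -> reconstructs fw c z f h i (i + k) P ->
  exists b, (forall t, P (z + t * h) = polyn b k t) /\
    forall j, (i <= j <= i + k)%nat -> sample fw c (polyn b k) j = data fw c z f h j.
Proof.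
  intros Hik Hh ((a & Ha) & Hdata). replace (i + k - i)%nat with k in Ha by lia.
  destruct (poly_rescale a k z h) as (b & Hb & _).
  assert (HP : forall t, P (z + t * h) = polyn b k t) by (intros; rewrite Ha; apply Hb).
  exists b. split; [exact HP|]. intros j Hj. rewrite <- Hdata by exact Hj.
  rewrite data_sample; try lia; try exact Hh.
  - apply sample_ext. intros t. symmetry. apply HP.
  - intros t _. apply (continuous_ext (polyn a k)); [intros; symmetry; apply Ha|].
    apply continuous_poly.
Qed.

(** Reconstruction is near-best: its error is controlled by that of any
    polynomial that matches the data approximately.  The constant depends
    neither on [h] nor on the function, by scaling. *)
Lemma reconstruction_near_best i k :
  (i + k <= n - 1)%nat ->
  exists C, 0 <= C /\ forall f z h P tau M t,
    0 < h -> reconstructs fw c z f h i (i + k) P ->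
    (forall j, (i <= j <= i + k)%nat ->
       Rabs (data fw c z f h j - sample fw c (polyn tau k) j) <= M) ->
    Rabs t <= B -> Rabs (P (z + t * h) - polyn tau k t) <= C * M.
Proof.
  intros Hik. destruct (sample_stable i k Hik) as (C & HC & HS).
  exists (INR (S k) * B ^ k * C). split.
  { apply Rmult_le_pos; [|exact HC].
    apply Rmult_le_pos; [apply pos_INR|apply pow_le; lra]. }
  intros f z h P tau M t Hh HP HM Ht.
  destruct (reconstructs_rescaled f z h i k P Hik Hh HP) as (b & Hb & Hdata).
  rewrite Hb, poly_sub, Rmult_assoc. apply poly_bound; auto.
  apply HS. intros j Hj.
  specialize (HM j Hj). rewrite <- Hdata in HM by exact Hj.
  rewrite sample_minus in HM by (try lia; intros; apply continuous_poly).
  now rewrite (sample_ext _ _ j (poly_sub b tau k)) in HM.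
Qed.

(** The divided difference is the leading coefficient itself; the derivative of
    order [n - 1] is the leading coefficient times a factorial. *)
Definition lead_factor : R :=
  match fw with point_values => 1 | cell_averages => INR (fact (n - 1)) end.

Lemma lead_factor_pos : 0 < lead_factor.
Proof.
  unfold lead_factor. destruct fw; [lra|apply INR_fact_lt_0].
Qed.

Lemma global_indicator_lead f z h p :
  0 < h -> reconstructs fw c z f h 0 (n - 1) p ->
  exists b,
    (forall j, (j <= n - 1)%nat -> sample fw c (polyn b (n - 1)) j = data fw c z f h j) /\
    global_indicator fw n c z f p h = (lead_factor * b (n - 1)%nat) ^ 2.
Proof.
  intros Hh Hp.
  destruct (reconstructs_rescaled f z h 0 (n - 1) p ltac:(lia) Hh Hp) as (b & Hb & Hdata).
  exists b. split; [intros j Hj; apply Hdata; lia|].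
  unfold global_indicator, lead_factor.
  unfold sample in Hdata. unfold increasing_nodes, last_node in c_incr.
  destruct fw eqn:E.
  - f_equal. rewrite Rmult_1_l.
    rewrite <- (undivided_poly c b (n - 1) 0) by (intros; apply c_incr; lia).
    apply undivided_ext. intros j Hj. symmetry. apply Hdata. lia.
  - f_equal. destruct Hp as ((a & Ha) & _). rewrite Nat.sub_0_r in Ha.
    rewrite (Derive_n_ext _ (polyn a (n - 1))) by exact Ha.
    rewrite Derive_n_lead.
    destruct (poly_rescale a (n - 1) z h) as (b' & Hb' & Hlead).
    assert (Hbb : b (n - 1)%nat = b' (n - 1)%nat).
    { assert (Hbt : forall t, polyn b (n - 1) t = polyn b' (n - 1) t).
      { intros t. rewrite <- Hb, <- Hb'. apply Ha. }
      apply Rmult_eq_reg_l with (INR (fact (n - 1))); [|apply INR_fact_neq_0].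
      rewrite <- !(Derive_n_lead _ _ 0). now apply Derive_n_ext. }
    rewrite Hbb, Hlead. ring.
Qed.

Lemma global_indicator_near :
  exists C, 0 <= C /\ forall f z h p tau M,
    0 < h -> reconstructs fw c z f h 0 (n - 1) p ->
    (forall j, (j <= n - 1)%nat ->
       Rabs (data fw c z f h j - sample fw c (polyn tau (n - 1)) j) <= M) ->
    exists e, Rabs e <= C * M /\
      global_indicator fw n c z f p h = (lead_factor * (tau (n - 1)%nat + e)) ^ 2.
Proof.
  destruct (sample_stable 0 (n - 1) ltac:(lia)) as (C & HC & HS).
  exists C. split; [exact HC|]. intros f z h p tau M Hh Hp HM.
  destruct (global_indicator_lead f z h p Hh Hp) as (b & Hb & Hd).
  exists (b (n - 1)%nat - tau (n - 1)%nat). split.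
  - apply (HS (fun l => b l - tau l)); [|lia]. intros j Hj.
    specialize (HM j ltac:(lia)). rewrite <- Hb in HM by lia.
    rewrite sample_minus in HM by (try lia; intros; apply continuous_poly).
    now rewrite (sample_ext _ _ j (poly_sub b tau (n - 1))) in HM.
  - rewrite Hd. do 2 f_equal. ring.
Qed.

(** A polynomial of degree at most [n - 2] cannot have step data: between two
    equal neighbouring data its derivative has a zero, which makes [n - 2]
    zeros for a derivative of degree at most [n - 3]. *)
Lemma step_lead_neq0 tau m u v :
  (0 < m < n)%nat -> u <> v ->
  (forall j, (j < m)%nat -> sample fw c (polyn tau (n - 1)) j = u) ->
  (forall j, (m <= j < n)%nat -> sample fw c (polyn tau (n - 1)) j = v) ->
  tau (n - 1)%nat <> 0.
Proof.
  intros Hm Huv Hu Hv H0.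
  assert (Hn : exists k, n = S (S (S k))) by (exists (n - 3)%nat; lia).
  destruct Hn as (k & Hn).
  replace (n - 1)%nat with (S (S k)) in * by lia.
  set (da := fun l => INR (S l) * tau (S l)).
  assert (Htrunc : forall x, polyn tau (S (S k)) x = polyn tau (S k) x)
    by (intros; rewrite poly_last, H0; ring).
  destruct (choose_upto (S (S k)) (fun j t => inside fw c j t /\
    sample fw c (polyn tau (S (S k))) j = polyn tau (S k) t)) as (t & Ht).
  { intros j Hj. destruct (sample_poly_mean tau (S (S k)) j ltac:(lia)) as (t & Ht1 & Ht2).
    exists t. now rewrite Ht2, Htrunc. }
  assert (Hincr : forall i j, (i < j <= S (S k))%nat -> t i < t j).
  { intros i j Hij. apply (inside_lt i j); [lia|apply Ht; lia|apply Ht; lia]. }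
  (* The gaps are numbered in order, with the gap of the step left out. *)
  set (gap := fun j => if lt_dec (S j) m then j else S j).
  destruct (choose_upto k (fun j y =>
    (t (gap j) < y < t (S (gap j))) /\ polyn da k y = 0)) as (y & Hy).
  { intros j Hj. apply (rolle (polyn tau (S k))).
    - apply Hincr. unfold gap. destruct (lt_dec (S j) m); lia.
    - intros x. apply is_derive_poly.
    - unfold gap. destruct (lt_dec (S j) m).
      + destruct (Ht j ltac:(lia)) as (_ & <-). destruct (Ht (S j) ltac:(lia)) as (_ & <-).
        rewrite !Hu by lia. reflexivity.
      + destruct (Ht (S j) ltac:(lia)) as (_ & <-). destruct (Ht (S (S j)) ltac:(lia)) as (_ & <-).
        rewrite !Hv by lia. reflexivity. }
  destruct (interpolation_stable k y) as (C & HC & HS).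
  { intros i j Hij. apply Rlt_le_trans with (t (S (gap i))); [apply Hy; lia|].
    apply Rle_trans with (t (gap j)); [|apply Rlt_le, Hy; lia].
    assert (Hle : (S (gap i) <= gap j)%nat)
      by (unfold gap; destruct (lt_dec (S i) m), (lt_dec (S j) m); lia).
    destruct (Nat.eq_dec (S (gap i)) (gap j)) as [->|]; [lra|].
    apply Rlt_le, Hincr. unfold gap in *. destruct (lt_dec (S j) m); lia. }
  assert (Hda : forall l, (l <= k)%nat -> da l = 0).
  { intros l Hl. assert (Rabs (da l) <= C * 0).
    { apply HS; [|exact Hl]. intros j Hj. rewrite (proj2 (Hy j Hj)), Rabs_R0. lra. }
    pose proof (Rabs_pos (da l)). apply Rabs_eq_0. lra. }
  assert (Hconst : forall x, polyn tau (S k) x = tau 0%nat).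
  { intros x. rewrite poly_head, (poly_ext _ (fun _ => 0)).
    - unfold polyn. rewrite sum_eq_R0 by (intros; ring). ring.
    - intros l Hl. apply Rmult_eq_reg_l with (INR (S l)); [|apply not_0_INR; lia].
      rewrite Rmult_0_r. apply (Hda l Hl). }
  apply Huv. rewrite <- (Hu 0%nat), <- (Hv (S (S k))) by lia.
  rewrite (proj2 (Ht 0%nat ltac:(lia))), (proj2 (Ht (S (S k)) ltac:(lia))).
  now rewrite !Hconst.
Qed.

(** Two neighbouring data of [t ^ m] may coincide when [m] is even, but three
    in a row may not: the derivative vanishes at the origin only. *)
Lemma power_data_differ m i k :
  (1 <= m)%nat -> (1 <= k)%nat -> (k = 1%nat -> m = 1%nat) -> (i + k <= n - 1)%nat ->
  exists j, (i <= j < i + k)%nat /\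
    sample fw c (fun t => t ^ m) j <> sample fw c (fun t => t ^ m) (S j).
Proof.
  intros Hm Hk Hkm Hik.
  assert (Hpt : forall j, (j <= n - 1)%nat ->
    exists t, inside fw c j t /\ sample fw c (fun t => t ^ m) j = t ^ m).
  { intros j Hj.
    set (a := fun l => if Nat.eq_dec l m then 1 else 0).
    assert (Ha : forall t, polyn a m t = t ^ m).
    { intros t. destruct m as [|m']; [lia|]. rewrite poly_last.
      rewrite (poly_ext _ (fun _ => 0)).
      - unfold polyn. rewrite sum_eq_R0 by (intros; ring).
        unfold a. destruct (Nat.eq_dec (S m') (S m')); [ring|lia].
      - intros l Hl. unfold a. destruct (Nat.eq_dec l (S m')); [lia|reflexivity]. }
    destruct (sample_poly_mean a m j Hj) as (t & Ht1 & Ht2).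
    exists t. split; [exact Ht1|].
    rewrite <- Ha, <- Ht2. now apply sample_ext. }
  assert (Hlt : forall j x y, (S j <= n - 1)%nat ->
    inside fw c j x -> inside fw c (S j) y -> x < y)
    by (intros j x y Hj; apply inside_lt; lia).
  destruct (Hpt i ltac:(lia)) as (x & Hx & Ex).
  destruct (Hpt (S i) ltac:(lia)) as (y & Hy & Ey).
  pose proof (Hlt i x y ltac:(lia) Hx Hy) as Hxy.
  destruct (Req_dec (x ^ m) (y ^ m)) as [Exy|]; [|exists i; split; [lia|congruence]].
  destruct (Nat.eq_dec m 1) as [->|Hm1]; [simpl in Exy; lra|].
  destruct (Hpt (S (S i)) ltac:(lia)) as (w & Hw & Ew).
  pose proof (Hlt (S i) y w ltac:(lia) Hy Hw) as Hyw.
  exists (S i). split; [lia|]. rewrite Ey, Ew. intros Eyw.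
  assert (Hd : forall t : R, is_derive (fun t => t ^ m) t (INR m * t ^ (m - 1))).
  { intros t. auto_derive; [exact I|]. replace (Nat.pred m) with (m - 1)%nat by lia. ring. }
  assert (Hzero : forall t, INR m * t ^ (m - 1) = 0 -> t = 0).
  { intros t Ht. apply Rmult_integral in Ht. destruct Ht as [Ht|Ht].
    - exfalso. revert Ht. apply not_0_INR. lia.
    - destruct (Req_dec t 0) as [|Hne]; [assumption|].
      exfalso. revert Ht. now apply pow_nonzero. }
  destruct (rolle _ _ x y Hxy Hd Exy) as (t1 & Ht1 & E1).
  destruct (rolle _ _ y w Hyw Hd Eyw) as (t2 & Ht2 & E2).
  apply Hzero in E1, E2. lra.
Qed.

(** * Smooth data *)

Variables (z cs : R).
Hypothesis cs_bound : Rabs cs <= B.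

Lemma data_taylor g k :
  C_near n g z -> (S k <= n)%nat ->
  exists C, 0 <= C /\ at_right 0 (fun h => 0 < h < 1 /\ forall j, (j <= n - 1)%nat ->
    Rabs (data fw c z g h j - sample fw c (polyn (taylor_coef g z h) k) j) <= C * h ^ S k).
Proof.
  intros Hg Hk. destruct (taylor_rescaled n k g z B Hg Hk B_ge1) as (C & HC & H).
  exists C. split; [exact HC|].
  generalize (filter_and _ _ H (at_right_lt 1 Rlt_0_1)).
  apply filter_imp. intros h (Ht & Hh). split; [exact Hh|]. intros j Hj.
  rewrite data_sample by (try lia; try lra; intros; apply Ht; assumption).
  apply sample_dist; auto.
  - intros t HtB. apply continuous_rescale. now apply Ht.
  - intros; apply continuous_poly.
  - intros t HtB. now apply Ht.
Qed.

Lemma sample_const a j : (j <= n - 1)%nat -> sample fw c (polyn a 0) j = a 0%nat.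
Proof.
  intros Hj. destruct (sample_poly_mean a 0 j Hj) as (t & _ & ->).
  unfold polyn; simpl; ring.
Qed.

Lemma data_near_base g :
  C_near n g z ->
  exists C, 0 <= C /\ at_right 0 (fun h => 0 < h < 1 /\ forall j, (j <= n - 1)%nat ->
    Rabs (data fw c z g h j - g z) <= C * h).
Proof.
  intros Hg. destruct (data_taylor g 0 Hg ltac:(lia)) as (C & HC & H).
  exists C. split; [exact HC|]. revert H. apply filter_imp. intros h (Hh & H).
  split; [exact Hh|]. intros j Hj. specialize (H j Hj).
  rewrite sample_const in H by exact Hj. unfold taylor_coef in H; simpl in H.
  replace (g z / 1 * 1) with (g z) in H by field. lra.
Qed.

(** When the derivatives of order [k + 1] to [q] vanish, the Taylor polynomial
    of degree [q] has degree at most [k] and can be compared with the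
    reconstruction, which gains [q - k] orders. *)
Lemma reconstruction_accuracy g i k q :
  C_near n g z -> (i + k <= n - 1)%nat -> (k <= q)%nat -> (S q <= n)%nat ->
  (forall l, (k < l <= q)%nat -> Derive_n g l z = 0) ->
  exists C, at_right 0 (fun h => 0 < h /\ forall f P,
    reconstructs fw c z f h i (i + k) P ->
    (forall j, (i <= j <= i + k)%nat -> data fw c z f h j = data fw c z g h j) ->
    Rabs (P (z + cs * h) - g (z + cs * h)) <= C * h ^ S q).
Proof.
  intros Hg Hik Hkq Hq Hvan.
  destruct (taylor_rescaled n q g z B Hg Hq B_ge1) as (C1 & HC1 & H1).
  destruct (data_taylor g q Hg Hq) as (C2 & HC2 & H2).
  destruct (reconstruction_near_best i k Hik) as (C3 & HC3 & H3).
  exists (C3 * C2 + C1). generalize (filter_and _ _ H1 H2). apply filter_imp.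
  intros h (Ht & Hh & Hd). split; [lra|]. intros f P HP Hdata.
  assert (Hpoly : forall t, polyn (taylor_coef g z h) q t = polyn (taylor_coef g z h) k t).
  { intros t. clear - Hvan Hkq. induction q as [|q IH]; [now replace k with 0%nat by lia|].
    destruct (Nat.eq_dec k (S q)) as [->|]; [reflexivity|].
    rewrite poly_last, IH by (try lia; intros; apply Hvan; lia).
    unfold taylor_coef at 2. rewrite Hvan by lia. unfold Rdiv. ring. }
  replace (P (z + cs * h) - g (z + cs * h)) with
    ((P (z + cs * h) - polyn (taylor_coef g z h) k cs) -
     (g (z + cs * h) - polyn (taylor_coef g z h) k cs)) by ring.
  unfold Rminus at 1. eapply Rle_trans; [apply Rabs_triang|]. rewrite Rabs_Ropp.
  rewrite Rmult_plus_distr_r. apply Rplus_le_compat.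
  - rewrite Rmult_assoc. apply (H3 f); auto; [lra|]. intros j Hj.
    rewrite Hdata by exact Hj. rewrite <- (sample_ext _ _ j Hpoly). apply Hd. lia.
  - rewrite <- Hpoly. now apply Ht.
Qed.

Lemma substencil_range i : (i <= rhigh n)%nat -> (i + rlow n <= n - 1)%nat.
Proof.
  unfold rhigh, rlow. intros Hi.
  pose proof (Nat.div_mod n 2 ltac:(lia)). pose proof (Nat.div_mod (n - 1) 2 ltac:(lia)).
  pose proof (Nat.mod_upper_bound n 2 ltac:(lia)).
  pose proof (Nat.mod_upper_bound (n - 1) 2 ltac:(lia)). lia.
Qed.

Lemma rlow_bounds : (1 <= rlow n)%nat /\ (S (rlow n) <= n)%nat /\ (n <= 2 * (rlow n + 1))%nat.
Proof.
  unfold rlow.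
  pose proof (Nat.div_mod (n - 1) 2 ltac:(lia)).
  pose proof (Nat.mod_upper_bound (n - 1) 2 ltac:(lia)). lia.
Qed.

Lemma abscissa_incr j : (S j <= n - 1)%nat -> 0 < abscissa fw c (j + 1) - abscissa fw c j.
Proof.
  intros Hj. rewrite Nat.add_1_r. unfold increasing_nodes, last_node in c_incr.
  unfold abscissa. destruct fw.
  - pose proof (c_incr j (S j) ltac:(lia)). lra.
  - pose proof (c_incr j (S j) ltac:(lia)). pose proof (c_incr (S j) (S (S j)) ltac:(lia)). lra.
Qed.

Lemma smoothness_ge_term f h i j :
  (i <= j < i + rlow n)%nat ->
  ((data fw c z f h (j + 1) - data fw c z f h j) /
     (abscissa fw c (j + 1) - abscissa fw c j)) ^ 2 <= smoothness fw n c z f h i.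
Proof.
  intros Hj. unfold smoothness, sum_f.
  set (u := fun j => ((data fw c z f h (j + 1) - data fw c z f h j) /
     (abscissa fw c (j + 1) - abscissa fw c j)) ^ 2).
  replace (((data fw c z f h (j + 1) - data fw c z f h j) /
     (abscissa fw c (j + 1) - abscissa fw c j)) ^ 2) with (u (j - i + i)%nat)
    by (unfold u; now replace (j - i + i)%nat with j by lia).
  apply (sum_ge_term (fun x => u (x + i)%nat)); [|lia].
  intros; apply pow2_ge_0.
Qed.

Lemma smoothness_nonneg f h i : 0 <= smoothness fw n c z f h i.
Proof.
  apply sum_nonneg. intros; apply pow2_ge_0.
Qed.

(** Up to [O (h ^ (m + 1))] the data are those of [f z + lam h ^ m t ^ m], and
    some neighbouring data of [t ^ m] differ.  When [rlow n = 1] there is a single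
    pair of neighbours, which only [m = 1] is sure to separate. *)
Lemma smoothness_lower_bound f m i :
  C_near n f z -> (1 <= m <= n - 1)%nat -> Derive_n f m z <> 0 ->
  (forall l, (1 <= l < m)%nat -> Derive_n f l z = 0) ->
  (rlow n = 1%nat -> m = 1%nat) -> (i <= rhigh n)%nat ->
  exists C, at_right 0 (fun h => 0 < h /\ h ^ (2 * m) <= C * smoothness fw n c z f h i).
Proof.
  intros Hf Hm Hnz Hvan Hr Hi.
  pose proof (substencil_range i Hi) as Hir. pose proof rlow_bounds as (Hr1 & _ & _).
  destruct (power_data_differ m i (rlow n)) as (j & Hj & Hmu); try lia; try assumption.
  destruct (data_taylor f m Hf ltac:(lia)) as (C & HC & H).
  set (mu := sample fw c (fun t => t ^ m)) in *.
  set (lam := Derive_n f m z / INR (fact m)).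
  assert (Hlam : lam <> 0).
  { unfold lam, Rdiv. apply Rmult_integral_contrapositive_currified; [exact Hnz|].
    apply Rinv_neq_0_compat, INR_fact_neq_0. }
  set (e := Rabs (lam * (mu (S j) - mu j))).
  assert (He : 0 < e).
  { apply Rabs_pos_lt, Rmult_integral_contrapositive_currified; [exact Hlam|lra]. }
  pose proof (abscissa_incr j ltac:(lia)) as Hgap.
  pose proof (smoothness_ge_term f) as Hterm.
  set (gap := abscissa fw c (j + 1) - abscissa fw c j) in *.
  exists ((2 * gap / e) ^ 2).
  assert (Hsmall : 0 < e / (4 * (C + 1))) by (apply Rdiv_lt_0_compat; lra).
  generalize (filter_and _ _ H (at_right_lt _ Hsmall)). apply filter_imp.
  intros h ((Hh & Hd) & Hhe). split; [lra|].
  assert (Hhm : 0 < h ^ m) by (apply pow_lt; lra).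
  assert (HCh : 4 * C * h <= e).
  { apply Rle_trans with (4 * (C + 1) * h); [nra|].
    apply Rmult_le_reg_l with (/ (4 * (C + 1))); [apply Rinv_0_lt_compat; lra|].
    rewrite <- Rmult_assoc, Rinv_l by lra. unfold Rdiv in Hhe. lra. }
  assert (Hpoly : forall t, polyn (taylor_coef f z h) m t = f z + lam * h ^ m * t ^ m).
  { intros t. destruct m as [|m']; [lia|]. rewrite poly_last.
    unfold taylor_coef at 2. fold lam. f_equal.
    destruct m' as [|m''].
    - unfold polyn, taylor_coef; simpl. field.
    - rewrite poly_head, (poly_ext _ (fun _ => 0)).
      + unfold polyn. rewrite sum_eq_R0 by (intros; ring).
        unfold taylor_coef; simpl; field.
      + intros l Hl. unfold taylor_coef. rewrite Hvan by lia. unfold Rdiv. ring. }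
  assert (Hsample : forall j', (j' <= n - 1)%nat ->
    sample fw c (polyn (taylor_coef f z h) m) j' = f z + lam * h ^ m * mu j').
  { intros j' Hj'. rewrite (sample_ext _ _ j' Hpoly). apply sample_affine; [exact Hj'|].
    intros t _. apply @ex_derive_continuous. auto_derive. exact I. }
  pose proof (Hd j ltac:(lia)) as H1. pose proof (Hd (S j) ltac:(lia)) as H2.
  rewrite Hsample in H1, H2 by lia.
  specialize (Hterm h i j Hj). fold gap in Hterm. rewrite Nat.add_1_r in Hterm.
  set (v1 := data fw c z f h j) in *. set (v2 := data fw c z f h (S j)) in *.
  assert (Hdiff : e / 2 * h ^ m <= Rabs (v2 - v1)).
  { replace (v2 - v1) with (lam * (mu (S j) - mu j) * h ^ m -
      ((v1 - (f z + lam * h ^ m * mu j)) - (v2 - (f z + lam * h ^ m * mu (S j))))) by ring.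
    eapply Rle_trans; [|apply Rabs_triang_inv].
    rewrite Rabs_mult, (Rabs_right (h ^ m)) by lra. fold e.
    assert (Hrest : Rabs (v1 - (f z + lam * h ^ m * mu j) -
        (v2 - (f z + lam * h ^ m * mu (S j)))) <= 2 * C * h * h ^ m).
    { unfold Rminus at 1. eapply Rle_trans; [apply Rabs_triang|]. rewrite Rabs_Ropp.
      rewrite <- tech_pow_Rmult in H1, H2. lra. }
    nra. }
  apply Rle_trans with ((2 * gap / e) ^ 2 * ((v2 - v1) / gap) ^ 2);
    [|apply Rmult_le_compat_l; [apply pow2_ge_0|exact Hterm]].
  rewrite <- Rpow_mult_distr, Nat.mul_comm, pow_mult.
  apply Rle_trans with ((2 / e * Rabs (v2 - v1)) ^ 2).
  - apply pow_incr. split; [lra|].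
    replace (h ^ m) with (2 / e * (e / 2 * h ^ m)) by (field; lra).
    apply Rmult_le_compat_l; [|exact Hdiff]. apply Rlt_le, Rdiv_lt_0_compat; lra.
  - rewrite Rpow_mult_distr, pow2_abs. apply Req_le. field. lra.
Qed.

(** The leading coefficient of the rescaled Taylor polynomial carries the factor
    [h ^ (n - 1)], and the reconstruction deviates from it by [O (h ^ n)] only. *)
Lemma global_indicator_upper_bound f :
  C_near n f z ->
  exists C, at_right 0 (fun h => 0 < h < 1 /\ 0 <= C /\ forall p,
    reconstructs fw c z f h 0 (n - 1) p ->
    global_indicator fw n c z f p h <= C * h ^ (2 * (n - 1))).
Proof.
  intros Hf. destruct (data_taylor f (n - 1) Hf ltac:(lia)) as (C1 & HC1 & H1).
  destruct global_indicator_near as (C2 & HC2 & H2).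
  set (D := Rabs (Derive_n f (n - 1) z / INR (fact (n - 1)))).
  exists ((lead_factor * (D + C2 * C1)) ^ 2).
  revert H1. apply filter_imp. intros h (Hh & Hd).
  split; [exact Hh|]. split; [apply pow2_ge_0|]. intros p Hp.
  destruct (H2 f z h p _ _ ltac:(lra) Hp Hd) as (e & He & ->).
  pose proof lead_factor_pos as HK.
  assert (Hhn : 0 < h ^ (n - 1)) by (apply pow_lt; lra).
  rewrite (Nat.mul_comm 2), pow_mult, <- Rpow_mult_distr, <- pow2_abs.
  apply pow_incr. split; [apply Rabs_pos|].
  rewrite Rabs_mult, (Rabs_right lead_factor), Rmult_assoc by lra.
  apply Rmult_le_compat_l; [lra|].
  eapply Rle_trans; [apply Rabs_triang|]. rewrite Rmult_plus_distr_r.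
  apply Rplus_le_compat.
  - unfold taylor_coef. rewrite Rabs_mult, (Rabs_right (h ^ _)) by lra. apply Rle_refl.
  - eapply Rle_trans; [exact He|]. rewrite <- tech_pow_Rmult.
    assert (0 <= C2 * C1 * h ^ (n - 1)) by (apply Rmult_le_pos; nra). nra.
Qed.

(** Either the global indicator is smaller than every local one by a factor
    [h ^ 2], so that the global reconstruction takes over, or [f] is constant
    to the order [h ^ n] and any weights will do. *)
Lemma smooth_error f s :
  C_near n f z -> (INR (rlow n) + 1) / 2 <= s ->
  ((n <= 4)%nat -> ~ critical_point f z) ->
  ((5 <= n)%nat -> ~ critical_point_of_order (n - 2) f z) ->
  exists C, at_right 0 (fun h => 0 < h /\ forall eps q, 0 < eps ->
    weno_value fw n c z f cs s h eps q -> Rabs (q - f (z + cs * h)) <= C * h ^ n).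
Proof.
  intros Hf Hs Hc4 Hc5. pose proof rlow_bounds as (Hr1 & Hrn & Hn2r).
  assert (Hex : forall l, (l <= n)%nat -> is_derive_n f l z (Derive_n f l z)).
  { intros l Hl. apply Derive_n_correct. apply (proj1 (locally_singleton _ _ Hf)). exact Hl. }
  assert (Hlow : forall k, (forall l, (1 <= l <= k)%nat -> Derive_n f l z = 0) \/
    exists m, (1 <= m <= k)%nat /\ Derive_n f m z <> 0 /\
      forall l, (1 <= l < m)%nat -> Derive_n f l z = 0).
  { induction k as [|k [IH|(m & Hm & IH)]].
    - left. intros; lia.
    - destruct (Req_dec (Derive_n f (S k) z) 0) as [H0|H0].
      + left. intros l Hl. destruct (Nat.eq_dec l (S k)) as [->|]; [exact H0|apply IH; lia].
      + right. exists (S k). repeat split; try lia; [exact H0|]. intros; apply IH; lia.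
    - right. exists m. split; [lia|exact IH]. }
  assert (Hcases : (forall l, (1 <= l <= n - 1)%nat -> Derive_n f l z = 0) \/
    exists m, (1 <= m <= n - 2)%nat /\ Derive_n f m z <> 0 /\
      (forall l, (1 <= l < m)%nat -> Derive_n f l z = 0) /\ (rlow n = 1%nat -> m = 1%nat)).
  { assert (H5 : (n <= 4 \/ 5 <= n)%nat) by lia. destruct H5 as [H4|H5].
    - right. exists 1%nat. repeat split; try lia.
      intros H0. apply (Hc4 H4). unfold critical_point. rewrite <- H0.
      apply (Hex 1%nat). lia.
    - assert (Hr2 : rlow n <> 1%nat).
      { unfold rlow. pose proof (Nat.div_mod (n - 1) 2 ltac:(lia)).
        pose proof (Nat.mod_upper_bound (n - 1) 2 ltac:(lia)). lia. }
      destruct (Hlow (n - 2)%nat) as [H0|(m & Hm & Hnz & Hvan)].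
      + left. intros l Hl. destruct (Nat.eq_dec l (n - 1)) as [->|]; [|apply H0; lia].
        destruct (Req_dec (Derive_n f (n - 1) z) 0) as [|Hne]; [assumption|].
        exfalso. apply (Hc5 H5). split.
        * intros j Hj. rewrite <- (H0 j Hj). apply Hex. lia.
        * exists (Derive_n f (n - 1) z). split; [exact Hne|].
          replace (S (n - 2)) with (n - 1)%nat by lia. apply Hex. lia.
      + right. exists m. repeat split; try lia; try assumption. }
  destruct (reconstruction_accuracy f 0 (n - 1) (n - 1) Hf) as (Cp & Hp); try lia.
  replace (S (n - 1)) with n in Hp by lia.
  destruct Hcases as [Hflat|(m & Hm & Hnz & Hvan & Hrm)].
  - destruct (eventually_uniform (rhigh n) (fun i C h => 0 < h /\ forall P,
      reconstructs fw c z f h i (i + rlow n) P ->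
      Rabs (P (z + cs * h) - f (z + cs * h)) <= C * h ^ n)) as (C & HC & HP).
    { intros i C C' h HCC' (Hh & H). split; [exact Hh|]. intros P HP.
      eapply Rle_trans; [exact (H P HP)|]. apply Rmult_le_compat_r; [apply pow_le|]; lra. }
    { intros i Hi. pose proof (substencil_range i Hi).
      destruct (reconstruction_accuracy f i (rlow n) (n - 1) Hf) as (C & HC); try lia.
      { intros l Hl. apply Hflat. lia. }
      replace (S (n - 1)) with n in HC by lia. exists C.
      revert HC. apply filter_imp. intros h (Hh & H0). split; [exact Hh|].
      intros P HP. apply (H0 f); auto. }
    exists (Rmax Cp C). generalize (filter_and _ _ Hp HP). apply filter_imp.
    intros h ((Hh & H1) & H2). split; [exact Hh|].
    intros eps q Heps (p & P & Hrec & HrecP & ->).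
    assert (Hhn : 0 < h ^ n) by (apply pow_lt; lra).
    eapply Rle_trans; [apply weno_error_convex with (E := Rmax Cp C * h ^ n)
                         (E' := Rmax Cp C * h ^ n)|].
    + exact Heps.
    + eapply Rle_trans; [apply (H1 f p Hrec); auto|].
      apply Rmult_le_compat_r; [lra|apply Rmax_l].
    + intros i Hi. eapply Rle_trans; [apply (H2 i Hi); auto|].
      apply Rmult_le_compat_r; [lra|apply Rmax_r].
    + lra.
  - set (r := rlow n) in *.
    destruct (eventually_uniform (rhigh n) (fun i C h => 0 < h /\
      (forall P, reconstructs fw c z f h i (i + r) P ->
        Rabs (P (z + cs * h) - f (z + cs * h)) <= C * h ^ S r) /\
      h ^ (2 * m) <= C * smoothness fw n c z f h i)) as (C & HC & HP).
    { intros i C C' h HCC' (Hh & H & H'). split; [exact Hh|]. split.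
      - intros P HP. eapply Rle_trans; [exact (H P HP)|].
        apply Rmult_le_compat_r; [apply pow_le|]; lra.
      - eapply Rle_trans; [exact H'|]. apply Rmult_le_compat_r; [apply smoothness_nonneg|lra]. }
    { intros i Hi. pose proof (substencil_range i Hi) as Hir. fold r in Hir.
      destruct (reconstruction_accuracy f i r r Hf) as (C & HC); try lia.
      destruct (smoothness_lower_bound f m i Hf) as (C' & HC'); try assumption; try lia.
      exists (Rmax C C'). generalize (filter_and _ _ HC HC'). apply filter_imp.
      intros h ((Hh & H0) & _ & H0'). split; [exact Hh|]. split.
      - intros P HP. eapply Rle_trans; [apply (H0 f); auto|].
        apply Rmult_le_compat_r; [apply pow_le; lra|apply Rmax_l].
      - eapply Rle_trans; [exact H0'|].
        apply Rmult_le_compat_r; [apply smoothness_nonneg|apply Rmax_r]. }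
    destruct (global_indicator_upper_bound f Hf) as (Cd & Hd).
    set (K := rpow (Cd * C) s). set (N := INR (S (rhigh n))).
    assert (HN : 0 <= N) by apply pos_INR.
    assert (HK : 0 <= K) by apply rpow_nonneg.
    exists (Rmax Cp 0 + N * K * C).
    generalize (filter_and _ _ Hp (filter_and _ _ HP Hd)). apply filter_imp.
    intros h ((Hh0 & H1) & H2 & Hh & HCd & Hd'). split; [exact Hh0|].
    intros eps q Heps (p & P & Hrec & HrecP & ->).
    assert (Hhn : 0 < h ^ n) by (apply pow_lt; lra).
    assert (Hhr : 0 < h ^ S r) by (apply pow_lt; lra).
    set (d := global_indicator fw n c z f p h).
    set (I := smoothness fw n c z f h).
    assert (Hratio : forall i, (i <= rhigh n)%nat -> rpow d s <= K * h ^ S r * rpow (I i) s).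
    { intros i Hi. apply rpow_indicator_ratio; try assumption.
      - rewrite S_INR. exact Hs.
      - nra.
      - apply smoothness_nonneg.
      - eapply Rle_trans; [apply (Hd' p Hrec)|].
        destruct (H2 i Hi) as (_ & _ & Hlb). fold (I i) in Hlb.
        replace (Cd * C * h ^ 2 * I i) with (Cd * (h ^ 2 * (C * I i))) by ring.
        apply Rmult_le_compat_l; [exact HCd|].
        apply Rle_trans with (h ^ 2 * h ^ (2 * m)).
        + rewrite <- pow_add. apply pow_antitone; [lra|lia].
        + apply Rmult_le_compat_l; [apply pow_le; lra|exact Hlb]. }
    eapply Rle_trans; [apply weno_error_convex with (E := Rmax Cp 0 * h ^ n)
                         (E' := C * h ^ S r)|].
    + exact Heps.
    + eapply Rle_trans; [apply (H1 f p Hrec); auto|].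
      apply Rmult_le_compat_r; [lra|apply Rmax_l].
    + intros i Hi. apply (H2 i Hi); auto.
    + fold d I.
      pose proof (global_weight_bounds n s eps d I Heps) as Hw.
      pose proof (global_weight_near_1 n s eps d I Heps (K * h ^ S r) Hratio ltac:(nra)) as Hw1.
      fold N in Hw1. set (w := global_weight n s eps d I) in *.
      assert (H2r : h ^ S r * h ^ S r <= h ^ n).
      { rewrite <- pow_add. apply pow_antitone; [lra|lia]. }
      rewrite Rmult_plus_distr_r. apply Rplus_le_compat.
      * pose proof (Rmax_r Cp 0). assert (0 <= Rmax Cp 0 * h ^ n) by nra. nra.
      * apply Rle_trans with (N * (K * h ^ S r) * (C * h ^ S r)).
        { apply Rmult_le_compat_r; [nra|exact Hw1]. }
        replace (N * (K * h ^ S r) * (C * h ^ S r))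
          with (N * K * C * (h ^ S r * h ^ S r)) by ring.
        apply Rmult_le_compat_l; [|exact H2r]. apply Rmult_le_pos; [nra|lra].
Qed.

(** * Data with a jump *)

Section Jump.

Variables (f fl fr : R -> R) (m : nat).
Hypothesis f_jump : jump n f fl fr z.
Hypothesis m_range : (0 < m < n)%nat.
Hypothesis m_left : forall h j, 0 < h -> (j < m)%nat -> left_element fw c z f fl z h j.
Hypothesis m_right : forall h j, 0 < h -> (m <= j < n)%nat -> right_element fw c z f fr z h j.

Lemma near_base_small d : 0 < d ->
  at_right 0 (fun h => 0 < h < 1 /\ forall t, Rabs t <= B -> Rabs (z + t * h - z) < d).
Proof.
  intros Hd. assert (HdB : 0 < d / B) by (apply Rdiv_lt_0_compat; lra).
  generalize (filter_and _ _ (at_right_lt _ HdB) (at_right_lt 1 Rlt_0_1)).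
  apply filter_imp. intros h (Hh & Hh1). split; [exact Hh1|]. intros t Ht.
  replace (z + t * h - z) with (t * h) by ring.
  rewrite Rabs_mult, (Rabs_right h) by lra.
  apply Rle_lt_trans with (B * h); [apply Rmult_le_compat_r; lra|].
  apply Rmult_lt_reg_l with (/ B); [apply Rinv_0_lt_compat; lra|].
  rewrite <- Rmult_assoc, Rinv_l by lra. unfold Rdiv in Hh. lra.
Qed.

Lemma jump_sides :
  at_right 0 (fun h => 0 < h < 1 /\ forall t, Rabs t <= B ->
    (left_point f fl z (z + t * h) -> f (z + t * h) = fl (z + t * h)) /\
    (right_point f fr z (z + t * h) -> f (z + t * h) = fr (z + t * h))).
Proof.
  destruct f_jump as (_ & _ & _ & (d & Hd)).
  generalize (near_base_small d (cond_pos d)). apply filter_imp.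
  intros h (Hh & Hball). split; [exact Hh|]. intros t Ht.
  destruct (Hd (z + t * h) (Hball t Ht)) as (Hl & Hr).
  split; intros [Hlt|(-> & E)]; auto.
Qed.

Lemma jump_data :
  at_right 0 (fun h => 0 < h < 1 /\
    (forall j, (j < m)%nat -> data fw c z f h j = data fw c z fl h j) /\
    (forall j, (m <= j < n)%nat -> data fw c z f h j = data fw c z fr h j)).
Proof.
  generalize jump_sides. apply filter_imp. intros h (Hh & Hside). split; [exact Hh|].
  (* A cell meets [z] at an end at most, where [f] does not affect the integral. *)
  assert (Hcell : forall j g, (j < n)%nat -> fw = cell_averages ->
    (forall t, Rabs t <= B -> node c z h j < z + t * h < node c z h (S j) ->
      f (z + t * h) = g (z + t * h)) ->
    RInt f (node c z h j) (node c z h (S j)) = RInt g (node c z h j) (node c z h (S j))).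
  { intros j g Hj E Hg. pose proof (cell_pos j E ltac:(lia)) as Hpos.
    apply RInt_ext. intros x. unfold node in *. rewrite Rmin_left, Rmax_right by nra.
    intros Hx. replace x with (z + (x - z) / h * h) in * by (field; lra).
    apply Hg; [|exact Hx]. apply (cell_bound j); [exact E|lia|].
    split; apply Rmult_le_reg_r with h; lra. }
  split; intros j Hj.
  - pose proof (m_left h j ltac:(lra) Hj) as Hel. unfold left_element in Hel.
    unfold data. destruct fw eqn:E.
    + apply Hside; [|exact Hel]. rewrite <- E in *. apply c_bound.
      rewrite E. unfold last_node. lia.
    + rewrite <- E in *. rewrite (Hcell j fl); auto; try lia.
      intros t Ht Hin. apply Hside; [exact Ht|]. left. lra.
  - pose proof (m_right h j ltac:(lra) Hj) as Hel. unfold right_element in Hel.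
    unfold data. destruct fw eqn:E.
    + apply Hside; [|exact Hel]. rewrite <- E in *. apply c_bound.
      rewrite E. unfold last_node. lia.
    + rewrite <- E in *. rewrite (Hcell j fr); auto; try lia.
      intros t Ht Hin. apply Hside; [exact Ht|]. left. lra.
Qed.

Lemma jump_data_near_step :
  exists C, 0 <= C /\ at_right 0 (fun h => 0 < h < 1 /\
    (forall j, (j < m)%nat -> Rabs (data fw c z f h j - fl z) <= C * h) /\
    (forall j, (m <= j < n)%nat -> Rabs (data fw c z f h j - fr z) <= C * h)).
Proof.
  destruct f_jump as (Hfl & Hfr & _).
  destruct (data_near_base fl Hfl) as (C1 & HC1 & H1).
  destruct (data_near_base fr Hfr) as (C2 & HC2 & H2).
  exists (C1 + C2). split; [lra|].
  generalize (filter_and _ _ jump_data (filter_and _ _ H1 H2)). apply filter_imp.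
  intros h ((Hh & Hl & Hr) & (_ & H1') & (_ & H2')). split; [exact Hh|].
  split; intros j Hj.
  - rewrite Hl by exact Hj. pose proof (H1' j ltac:(lia)). nra.
  - rewrite Hr by exact Hj. pose proof (H2' j ltac:(lia)). nra.
Qed.

(** The data tend to a step, so the global indicator stays away from zero. *)
Lemma jump_global_indicator :
  exists C, at_right 0 (fun h => forall p, reconstructs fw c z f h 0 (n - 1) p ->
    1 <= C * global_indicator fw n c z f p h).
Proof.
  destruct jump_data_near_step as (C1 & HC1 & H1).
  destruct global_indicator_near as (C2 & HC2 & H2).
  set (v := fun j => if lt_dec j m then fl z else fr z).
  destruct (sample_exists v) as (tau & Htau).
  assert (Hlead : tau (n - 1)%nat <> 0).
  { destruct f_jump as (_ & _ & Hne & _).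
    apply (step_lead_neq0 tau m (fl z) (fr z) m_range Hne).
    - intros j Hj. rewrite Htau by lia. unfold v. destruct (lt_dec j m); [reflexivity|lia].
    - intros j Hj. rewrite Htau by lia. unfold v. destruct (lt_dec j m); [lia|reflexivity]. }
  set (T := Rabs (tau (n - 1)%nat)). assert (HT : 0 < T) by now apply Rabs_pos_lt.
  pose proof lead_factor_pos as HK.
  assert (HKT : 0 < lead_factor * (T / 2)) by (apply Rmult_lt_0_compat; lra).
  exists (/ (lead_factor * (T / 2)) ^ 2).
  assert (HC12 : 0 <= C2 * C1) by (apply Rmult_le_pos; assumption).
  assert (Hsmall : 0 < T / (2 * (C2 * C1 + 1))) by (apply Rdiv_lt_0_compat; lra).
  generalize (filter_and _ _ H1 (at_right_lt _ Hsmall)). apply filter_imp.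
  intros h ((Hh & Hl & Hr) & HhT) p Hp.
  destruct (H2 f z h p tau (C1 * h)) as (e & He & ->); [lra|exact Hp| |].
  { intros j Hj. rewrite Htau by exact Hj. unfold v.
    destruct (lt_dec j m); [apply Hl; assumption|apply Hr; lia]. }
  assert (He2 : Rabs e <= T / 2).
  { eapply Rle_trans; [exact He|].
    apply Rle_trans with ((C2 * C1 + 1) * h); [nra|].
    assert (Hh2 := proj2 HhT). apply Rlt_div_r in Hh2; lra. }
  assert (Hsum : T / 2 <= Rabs (tau (n - 1)%nat + e)).
  { pose proof (Rabs_triang_inv (tau (n - 1)%nat) (- e)) as Htri.
    rewrite Rabs_Ropp in Htri. unfold Rminus in Htri. rewrite Ropp_involutive in Htri.
    fold T in Htri. lra. }
  assert (Hpow : 0 < (lead_factor * (T / 2)) ^ 2) by now apply pow_lt.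
  apply Rmult_le_reg_l with ((lead_factor * (T / 2)) ^ 2); [exact Hpow|].
  rewrite <- Rmult_assoc, Rinv_r, Rmult_1_r, Rmult_1_l by lra.
  rewrite <- (pow2_abs (lead_factor * (_ + _))). apply pow_incr. split; [lra|].
  rewrite Rabs_mult, (Rabs_right lead_factor) by lra.
  apply Rmult_le_compat_l; lra.
Qed.

(** One of the differences is taken across the jump. *)
Lemma jump_smoothness_crossed :
  exists C, at_right 0 (fun h => forall i, (i < m <= i + rlow n)%nat ->
    1 <= C * smoothness fw n c z f h i).
Proof.
  destruct jump_data_near_step as (C1 & HC1 & H1).
  pose proof (proj1 (proj2 (proj2 f_jump))) as Hne.
  set (T := Rabs (fr z - fl z)). assert (HT : 0 < T) by (apply Rabs_pos_lt; lra).
  pose proof (abscissa_incr (m - 1) ltac:(lia)) as Hgap.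
  set (gap := abscissa fw c (m - 1 + 1) - abscissa fw c (m - 1)) in *.
  exists ((2 * gap / T) ^ 2).
  assert (Hsmall : 0 < T / (4 * (C1 + 1))) by (apply Rdiv_lt_0_compat; lra).
  generalize (filter_and _ _ H1 (at_right_lt _ Hsmall)). apply filter_imp.
  intros h ((Hh & Hl & Hr) & HhT) i Hi.
  pose proof (smoothness_ge_term f h i (m - 1) ltac:(lia)) as Hterm. fold gap in Hterm.
  replace (m - 1 + 1)%nat with m in Hterm by lia.
  pose proof (Hl (m - 1)%nat ltac:(lia)) as H2. pose proof (Hr m ltac:(lia)) as H3.
  set (v1 := data fw c z f h (m - 1)) in *. set (v2 := data fw c z f h m) in *.
  assert (HCh : 4 * C1 * h <= T).
  { apply Rle_trans with (4 * (C1 + 1) * h); [nra|].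
    apply Rmult_le_reg_l with (/ (4 * (C1 + 1))); [apply Rinv_0_lt_compat; lra|].
    rewrite <- Rmult_assoc, Rinv_l by lra. unfold Rdiv in HhT. lra. }
  assert (Hdiff : T / 2 <= Rabs (v2 - v1)).
  { replace (v2 - v1) with ((fr z - fl z) - ((v1 - fl z) - (v2 - fr z))) by ring.
    eapply Rle_trans; [|apply Rabs_triang_inv]. fold T.
    assert (Rabs (v1 - fl z - (v2 - fr z)) <= 2 * C1 * h).
    { unfold Rminus at 1. eapply Rle_trans; [apply Rabs_triang|]. rewrite Rabs_Ropp. lra. }
    lra. }
  eapply Rle_trans; [|apply Rmult_le_compat_l; [apply pow2_ge_0|exact Hterm]].
  rewrite <- Rpow_mult_distr, <- pow2_abs, <- (pow1 2). apply pow_incr. split; [lra|].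
  replace (2 * gap / T * ((v2 - v1) / gap)) with (2 / T * (v2 - v1)) by (field; lra).
  rewrite Rabs_mult, (Rabs_right (2 / T)) by (apply Rle_ge, Rlt_le, Rdiv_lt_0_compat; lra).
  replace 1 with (2 / T * (T / 2)) by (field; lra).
  apply Rmult_le_compat_l; [apply Rlt_le, Rdiv_lt_0_compat; lra|exact Hdiff].
Qed.

(** All data of the substencil are within [O (h)] of one of the two limits. *)
Lemma jump_smoothness_uncrossed i :
  (i <= rhigh n)%nat -> (i + rlow n < m \/ m <= i)%nat ->
  exists C, 0 <= C /\ at_right 0 (fun h => smoothness fw n c z f h i <= C * h ^ 2).
Proof.
  intros Hi Hside. pose proof (substencil_range i Hi) as Hir.
  pose proof rlow_bounds as (Hr1 & _ & _).
  destruct jump_data_near_step as (C1 & HC1 & H1).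
  set (G := fun j => (2 * C1 / (abscissa fw c (j + 1) - abscissa fw c j)) ^ 2).
  exists (sum_f i (rlow n + i - 1) G). split.
  { apply sum_nonneg. intros; apply pow2_ge_0. }
  revert H1. apply filter_imp. intros h (Hh & Hl & Hr).
  unfold smoothness, sum_f. rewrite Rmult_comm, scal_sum. apply sum_Rle.
  intros x Hx. unfold G. set (j := (x + i)%nat).
  pose proof (abscissa_incr j ltac:(unfold j; lia)) as Hgap.
  set (gap := abscissa fw c (j + 1) - abscissa fw c j) in *.
  rewrite <- Rpow_mult_distr, <- pow2_abs. apply pow_incr. split; [apply Rabs_pos|].
  unfold Rdiv. rewrite Rabs_mult, (Rabs_right (/ gap))
    by (apply Rle_ge, Rlt_le, Rinv_0_lt_compat, Hgap).
  replace (2 * C1 * / gap * h) with (2 * C1 * h * / gap) by ring.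
  apply Rmult_le_compat_r; [apply Rlt_le, Rinv_0_lt_compat, Hgap|].
  assert (Hv : exists v, Rabs (data fw c z f h j - v) <= C1 * h /\
    Rabs (data fw c z f h (j + 1) - v) <= C1 * h).
  { destruct Hside; [exists (fl z); split; apply Hl|exists (fr z); split; apply Hr];
      unfold j; lia. }
  destruct Hv as (v & Hv1 & Hv2).
  replace (data fw c z f h (j + 1) - data fw c z f h j) with
    ((data fw c z f h (j + 1) - v) - (data fw c z f h j - v)) by ring.
  unfold Rminus at 1. eapply Rle_trans; [apply Rabs_triang|]. rewrite Rabs_Ropp. lra.
Qed.

Lemma jump_reconstruction_bounded i k :
  (i + k <= n - 1)%nat ->
  exists C, at_right 0 (fun h => forall P, reconstructs fw c z f h i (i + k) P ->
    Rabs (P (z + cs * h)) <= C).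
Proof.
  intros Hik. destruct jump_data_near_step as (C1 & HC1 & H1).
  destruct (reconstruction_near_best i k Hik) as (C2 & HC2 & H2).
  set (M := Rabs (fl z) + Rabs (fr z) + C1).
  exists (C2 * M). revert H1. apply filter_imp. intros h (Hh & Hl & Hr) P HP.
  assert (Hzero : forall t, polyn (fun _ => 0) k t = 0)
    by (intros; apply sum_eq_R0; intros; ring).
  replace (P (z + cs * h)) with (P (z + cs * h) - polyn (fun _ => 0) k cs)
    by (rewrite Hzero; ring).
  apply (H2 f); auto; [lra|]. intros j Hj.
  destruct (sample_poly_mean (fun _ => 0) k j ltac:(lia)) as (t & _ & ->).
  rewrite Hzero, Rminus_0_r.
  assert (Hone : forall v, Rabs (data fw c z f h j - v) <= C1 * h ->
    Rabs (data fw c z f h j) <= Rabs v + C1).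
  { intros v Hv. replace (data fw c z f h j) with (v + (data fw c z f h j - v)) by ring.
    eapply Rle_trans; [apply Rabs_triang|]. nra. }
  pose proof (Rabs_pos (fl z)). pose proof (Rabs_pos (fr z)). unfold M.
  destruct (lt_dec j m) as [Hjm|Hjm].
  - pose proof (Hone _ (Hl j Hjm)). lra.
  - pose proof (Hone _ (Hr j ltac:(lia))). lra.
Qed.

(** The first and the last substencil have at most one element in common, so
    the jump cannot cross both. *)
Lemma uncrossed_exists :
  exists i, (i <= rhigh n)%nat /\ (i + rlow n < m \/ m <= i)%nat.
Proof.
  assert (Hrr : (rlow n <= rhigh n)%nat) by (apply Nat.Div0.div_le_mono; lia).
  destruct (lt_dec (rlow n) m); [exists 0%nat|exists (rhigh n)]; lia.
Qed.

Hypothesis point_same_side :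
  at_right 0 (fun h => same_side fw n c z f fl fr z h (z + cs * h)).

Lemma uncrossed_side i :
  (i <= rhigh n)%nat ->
  at_right 0 (fun h => 0 < h < 1 /\
    ((i + rlow n < m)%nat -> f (z + cs * h) = fl (z + cs * h)) /\
    ((m <= i)%nat -> f (z + cs * h) = fr (z + cs * h))).
Proof.
  intros Hi. pose proof (substencil_range i Hi) as Hir.
  generalize (filter_and _ _ jump_sides point_same_side). apply filter_imp.
  intros h ((Hh & Hside) & Hss). split; [exact Hh|].
  destruct (Hss i Hi) as (Hl & Hr). destruct (Hside cs cs_bound) as (Hfl & Hfr).
  split; intros Hm.
  - apply Hfl, Hl. intros j Hj. apply m_left; [lra|lia].
  - apply Hfr, Hr. intros j Hj. apply m_right; [lra|lia].
Qed.

Lemma jump_value_bounded :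
  exists C, at_right 0 (fun h => Rabs (f (z + cs * h)) <= C).
Proof.
  destruct f_jump as (Hfl & Hfr & _).
  assert (Hbd : forall g, C_near n g z ->
    exists C, at_right 0 (fun h => Rabs (g (z + cs * h)) <= C)).
  { intros g Hg. destruct (C_near_bounded n 0 g z Hg ltac:(lia)) as (d & M & Hd & _ & H).
    exists M. generalize (near_base_small d Hd). apply filter_imp.
    intros h (_ & Hball). apply (H (z + cs * h)). now apply Hball. }
  destruct (Hbd fl Hfl) as (C1 & H1). destruct (Hbd fr Hfr) as (C2 & H2).
  exists (Rmax C1 C2). destruct uncrossed_exists as (i & Hi & Hside).
  generalize (filter_and _ _ (uncrossed_side i Hi) (filter_and _ _ H1 H2)).
  apply filter_imp. intros h ((_ & Hl & Hr) & H1' & H2').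
  destruct Hside as [Hs|Hs]; [rewrite Hl by exact Hs|rewrite Hr by exact Hs].
  - eapply Rle_trans; [exact H1'|apply Rmax_l].
  - eapply Rle_trans; [exact H2'|apply Rmax_r].
Qed.

Lemma jump_substencil_accuracy i :
  (i <= rhigh n)%nat -> (i + rlow n < m \/ m <= i)%nat ->
  exists C, at_right 0 (fun h => forall P, reconstructs fw c z f h i (i + rlow n) P ->
    Rabs (P (z + cs * h) - f (z + cs * h)) <= C * h ^ S (rlow n)).
Proof.
  intros Hi Hside. pose proof (substencil_range i Hi) as Hir.
  pose proof rlow_bounds as (_ & Hrn & _). destruct f_jump as (Hfl & Hfr & _).
  destruct Hside as [Hm|Hm].
  - destruct (reconstruction_accuracy fl i (rlow n) (rlow n) Hfl) as (C & HC); try lia.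
    exists C. generalize (filter_and _ _ HC (filter_and _ _ (uncrossed_side i Hi) jump_data)).
    apply filter_imp. intros h ((_ & H) & (_ & Hl & _) & _ & Hdl & _) P HP.
    rewrite Hl by exact Hm. apply (H f); [exact HP|]. intros j Hj. apply Hdl. lia.
  - destruct (reconstruction_accuracy fr i (rlow n) (rlow n) Hfr) as (C & HC); try lia.
    exists C. generalize (filter_and _ _ HC (filter_and _ _ (uncrossed_side i Hi) jump_data)).
    apply filter_imp. intros h ((_ & H) & (_ & _ & Hr) & _ & _ & Hdr) P HP.
    rewrite Hr by exact Hm. apply (H f); [exact HP|]. intros j Hj. apply Hdr. lia.
Qed.

Lemma rpow_1 s : rpow 1 s = 1.
Proof.
  unfold rpow. destruct (Rlt_dec 0 1); [|lra].
  unfold Rpower. rewrite ln_1, Rmult_0_r. apply exp_0.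
Qed.

Lemma jump_error s :
  (INR (rlow n) + 1) / 2 <= s ->
  exists C, at_right 0 (fun h => forall eps q, 0 < eps ->
    weno_value fw n c z f cs s h eps q ->
    Rabs (q - f (z + cs * h)) <= C * (h ^ S (rlow n) + eps)).
Proof.
  intros Hs. set (r := rlow n) in *.
  assert (Hs0 : 0 <= s) by (pose proof (pos_INR r); lra).
  assert (Hdist : forall u v a b, Rabs u <= a -> Rabs v <= b -> Rabs (u - v) <= a + b).
  { intros u v a b Hu Hv. unfold Rminus. eapply Rle_trans; [apply Rabs_triang|].
    rewrite Rabs_Ropp. lra. }
  destruct jump_value_bounded as (CF & HF).
  destruct (eventually_uniform (rhigh n) (fun i C h => 0 < h /\ forall P,
    reconstructs fw c z f h i (i + r) P ->
    Rabs (P (z + cs * h) - f (z + cs * h)) <= C * h ^ S r \/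
    (1 <= C * smoothness fw n c z f h i /\
     Rabs (P (z + cs * h) - f (z + cs * h)) <= C))) as (C & HC & HP).
  { intros i C C' h HCC' (Hh & H). split; [exact Hh|]. intros P HP.
    destruct (H P HP) as [HE|(HI & HG)]; [left|right; split].
    - eapply Rle_trans; [exact HE|]. apply Rmult_le_compat_r; [apply pow_le|]; lra.
    - eapply Rle_trans; [exact HI|]. apply Rmult_le_compat_r; [apply smoothness_nonneg|lra].
    - lra. }
  { intros i Hi. pose proof (substencil_range i Hi) as Hir.
    destruct (le_lt_dec m i) as [Hm|Hm].
    - destruct (jump_substencil_accuracy i Hi (or_intror Hm)) as (C & H). exists C.
      generalize (filter_and _ _ H (at_right_lt 1 Rlt_0_1)). apply filter_imp.
      intros h (H' & Hh). split; [lra|]. intros P HP. left. now apply H'.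
    - destruct (lt_dec (i + r) m) as [Hm'|Hm'].
      + destruct (jump_substencil_accuracy i Hi (or_introl Hm')) as (C & H). exists C.
        generalize (filter_and _ _ H (at_right_lt 1 Rlt_0_1)). apply filter_imp.
        intros h (H' & Hh). split; [lra|]. intros P HP. left. now apply H'.
      + destruct jump_smoothness_crossed as (C1 & H1).
        destruct (jump_reconstruction_bounded i r Hir) as (C2 & H2).
        exists (Rmax C1 (C2 + CF)).
        generalize (filter_and _ _ (filter_and _ _ H1 H2)
          (filter_and _ _ HF (at_right_lt 1 Rlt_0_1))). apply filter_imp.
        intros h ((H1' & H2') & HF' & Hh). split; [lra|]. intros P HP. right. split.
        * eapply Rle_trans; [apply (H1' i); unfold r in *; lia|].
          apply Rmult_le_compat_r; [apply smoothness_nonneg|apply Rmax_l].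
        * eapply Rle_trans; [|apply Rmax_r]. apply Hdist; auto. }
  destruct (jump_reconstruction_bounded 0 (n - 1) ltac:(lia)) as (Cp & Hp).
  destruct jump_global_indicator as (Cd & Hd).
  destruct uncrossed_exists as (i0 & Hi0 & Hside0).
  destruct (jump_smoothness_uncrossed i0 Hi0 Hside0) as (CI & HCI & HI).
  set (C' := Rmax C Cd). assert (HCC' : C <= C') by apply Rmax_l.
  set (K := rpow C' s). set (G := C + (Rabs Cp + Rabs CF)).
  set (N := INR (S (rhigh n))). set (KI := rpow CI s).
  assert (HK : 0 <= K) by apply rpow_nonneg. assert (HKI : 0 <= KI) by apply rpow_nonneg.
  assert (HN : 0 <= N) by apply pos_INR.
  assert (HG : 0 <= G) by (unfold G; pose proof (Rabs_pos Cp); pose proof (Rabs_pos CF); lra).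
  exists (N * C + (2 * N + 1) * (K * G) * (KI + 1)).
  generalize (filter_and _ _ (filter_and _ _ HF HP)
    (filter_and _ _ (filter_and _ _ Hp Hd) (filter_and _ _ HI (at_right_lt 1 Rlt_0_1)))).
  apply filter_imp. intros h ((HF' & HP') & (Hp' & Hd') & HI' & Hh) eps q Heps.
  intros (p & P & Hrec & HrecP & ->).
  set (d := global_indicator fw n c z f p h). set (I := smoothness fw n c z f h).
  assert (Hhr : 0 < h ^ S r) by (apply pow_lt; lra).
  (* Lower bounds survive taking powers. *)
  assert (Hpow : forall a b, a <= C' -> 0 <= b -> 1 <= a * b -> 1 <= K * rpow b s).
  { intros a b Ha Hb Hab. unfold K. rewrite <- rpow_mult by (try lra; nra).
    rewrite <- (rpow_1 s). apply rpow_mono; [exact Hs0|]. nra. }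
  assert (Hd1 : 1 <= K * rpow d s).
  { apply (Hpow Cd); [apply Rmax_r| |now apply Hd'].
    unfold d, global_indicator. destruct fw; apply pow2_ge_0. }
  assert (HI1 : rpow (I i0) s <= KI * h ^ S r).
  { rewrite <- (Rmult_1_r (KI * h ^ S r)), <- (rpow_1 s).
    apply rpow_indicator_ratio; try assumption; try lra.
    - rewrite S_INR. exact Hs.
    - rewrite Rmult_1_r. exact HI'. }
  eapply Rle_trans;
    [apply (weno_error_jump n s eps d I Heps _ _ _ i0 K (C * h ^ S r) G); try assumption|].
  - nra.
  - apply Rle_trans with (Rabs Cp + Rabs CF); [|unfold G; lra]. apply Hdist.
    + eapply Rle_trans; [now apply Hp'|apply Rle_abs].
    + eapply Rle_trans; [exact HF'|apply Rle_abs].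
  - intros i Hi. destruct (HP' i Hi) as (_ & Hi').
    destruct (Hi' _ (HrecP i Hi)) as [HE|(HI2 & HG2)]; [now left|right].
    split; [now apply (Hpow C); [|apply smoothness_nonneg|]|].
    unfold G. pose proof (Rabs_pos Cp). pose proof (Rabs_pos CF). lra.
  - fold N. set (A := (2 * N + 1) * (K * G)).
    assert (HA : 0 <= A) by (apply Rmult_le_pos; nra).
    replace ((N * C + A * (KI + 1)) * (h ^ S r + eps))
      with (N * (C * (h ^ S r + eps)) + A * ((KI + 1) * (h ^ S r + eps))) by ring.
    apply Rplus_le_compat; apply Rmult_le_compat_l; try assumption; nra.
Qed.

End Jump.

(** The nodes tend to [z] while the jump does not move, so it lies at [z], and
    the scaling of the nodes about [z] preserves the side of each element. *)
Lemma crosses_at_base f fl fr xi :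
  at_right 0 (fun h => crosses fw n c z f fl fr xi h) ->
  xi = z /\ exists m, (0 < m < n)%nat /\
    (forall h j, 0 < h -> (j < m)%nat -> left_element fw c z f fl z h j) /\
    (forall h j, 0 < h -> (m <= j < n)%nat -> right_element fw c z f fr z h j).
Proof.
  intros Hcross.
  assert (Hxi : xi = z).
  { destruct (Req_dec xi z) as [|Hne]; [assumption|exfalso].
    assert (Hd : 0 < Rabs (xi - z)) by (apply Rabs_pos_lt; lra).
    destruct (at_right_delta _ (filter_and _ _ Hcross (near_base_small _ Hd)))
      as (d & Hdpos & H).
    destruct (H (d / 2) ltac:(lra)) as ((m & Hm & Hl & Hr) & Hh & Hball).
    set (h := d / 2) in *.
    assert (Hleft : exists j, (j <= last_node fw n)%nat /\ node c z h j <= xi).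
    { pose proof (Hl 0%nat ltac:(lia)) as H0. unfold left_element, left_point in H0.
      unfold last_node. destruct fw; [exists 0%nat|exists 1%nat]; split; try lia; lra. }
    assert (Hright : exists j, (j <= last_node fw n)%nat /\ xi <= node c z h j).
    { pose proof (Hr (n - 1)%nat ltac:(lia)) as H0. unfold right_element, right_point in H0.
      exists (n - 1)%nat. unfold last_node. destruct fw; split; try lia; lra. }
    destruct Hleft as (j1 & Hj1 & H1). destruct Hright as (j2 & Hj2 & H2).
    pose proof (Hball _ (c_bound j1 Hj1)) as B1. pose proof (Hball _ (c_bound j2 Hj2)) as B2.
    unfold node in H1, H2. revert B1 B2. unfold Rabs.
    destruct (Rcase_abs _), (Rcase_abs _), (Rcase_abs _); lra. }
  split; [exact Hxi|]. subst xi.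
  destruct (at_right_delta _ Hcross) as (d & Hd & H).
  destruct (H (d / 2) ltac:(lra)) as (m & Hm & Hl & Hr). exists m. split; [exact Hm|].
  assert (Hsign : forall t h, 0 < h ->
    (z + t * (d / 2) < z -> z + t * h < z) /\ (z + t * (d / 2) = z -> z + t * h = z) /\
    (z < z + t * (d / 2) -> z < z + t * h)).
  { intros t h Hh. repeat split; intros Ht; assert (Ht' : t * (d / 2) < 0 \/ t * (d / 2) = 0 \/ 0 < t * (d / 2)) by lra; nra. }
  split; intros h j Hh Hj.
  - pose proof (Hl j Hj) as He. unfold left_element, left_point, node in *.
    destruct fw.
    + pose proof (Hsign (c j) h Hh) as (S1 & S2 & S3). tauto.
    + pose proof (Hsign (c (S j)) h Hh) as (S1 & S2 & S3).
      destruct He as [He|He]; [left; auto|right; auto].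
  - pose proof (Hr j Hj) as He. unfold right_element, right_point, node in *.
    destruct fw; pose proof (Hsign (c j) h Hh) as (S1 & S2 & S3).
    + tauto.
    + destruct He as [He|He]; [left; auto|right; symmetry; auto].
Qed.

End Sampling.

(** * The order of the reconstruction *)

Lemma stencil_bounded N (c : nat -> R) cs :
  exists B, 1 <= B /\ Rabs cs <= B /\ forall i, (i <= N)%nat -> Rabs (c i) <= B.
Proof.
  set (S := sum_f_R0 (fun i => Rabs (c i)) N).
  assert (HS : forall i, (i <= N)%nat -> Rabs (c i) <= S).
  { intros i Hi. apply (sum_ge_term (fun i => Rabs (c i))); [|exact Hi].
    intros; apply Rabs_pos. }
  pose proof (HS 0%nat ltac:(lia)). pose proof (Rabs_pos (c 0%nat)). pose proof (Rabs_pos cs).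
  exists (1 + Rabs cs + S). repeat split; try lra.
  intros i Hi. pose proof (HS i Hi). lra.
Qed.

Theorem theorem3p1 (fw : framework) (n : nat) (c : nat -> R) (z cs s : R)
    (f : R -> R) (q : R -> R -> R) :
  (3 <= n)%nat ->
  increasing_nodes fw n c ->
  point_position fw n c z cs ->
  (forall h eps, 0 < h -> 0 < eps -> weno_value fw n c z f cs s h eps (q h eps)) ->
  (INR (rlow n) + 1) / 2 <= s ->
  ((n <= 4)%nat -> ~ critical_point f z) ->
  ((5 <= n)%nat -> ~ critical_point_of_order (n - 2) f z) ->
  (C_near n f z ->
     bigO_h_eps n (fun h eps => q h eps - f (z + cs * h))) /\
  (forall (fl fr : R -> R) (xi : R),
     jump n f fl fr xi ->
     at_right 0 (fun h => crosses fw n c z f fl fr xi h) ->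
     at_right 0 (fun h => same_side fw n c z f fl fr xi h (z + cs * h)) ->
     bigO_h_eps (rlow n + 1) (fun h eps => q h eps - f (z + cs * h))).
Proof.
  intros Hn Hc _ Hq Hs Hc4 Hc5.
  destruct (stencil_bounded (last_node fw n) c cs) as (B & HB & Hcs & HcB).
  split.
  - intros Hf. apply bigO_of_sum_bound.
    destruct (smooth_error fw n c B Hn Hc HcB HB z cs Hcs f s Hf Hs Hc4 Hc5) as (C & HC).
    exists (Rmax C 0). revert HC. apply filter_imp. intros h (Hh & H) eps Heps.
    eapply Rle_trans; [apply (H eps); auto|].
    pose proof (pow_lt h n Hh). pose proof (Rmax_l C 0). pose proof (Rmax_r C 0). nra.
  - intros fl fr xi Hjump Hcross Hside. apply bigO_of_sum_bound.
    destruct (crosses_at_base fw n c B Hn Hc HcB HB z f fl fr xi Hcross)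
      as (-> & m & Hm & Hl & Hr).
    destruct (jump_error fw n c B Hn Hc HcB HB z cs Hcs f fl fr m Hjump Hm Hl Hr Hside s Hs)
      as (C & HC).
    exists C. generalize (filter_and _ _ HC (at_right_lt 1 Rlt_0_1)).
    apply filter_imp. intros h (H & Hh) eps Heps. rewrite Nat.add_1_r.
    apply (H eps); [exact Heps|]. apply Hq; lra.
Qed.
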